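(* For every gauge function $\phi$ there exists an $F_\sigma$ set $B\subset\mathbb{R}^d$ of zero Lebesgue measure such that $\bigl|\mathbb{R}^d\setminus(A+B)\bigr|=0$ for every Borel set $A\subset\mathbb{R}^d$ with $\mathcal{H}^\phi(A)>0$.
   Context: $|\cdot|$ denotes Lebesgue measure on $\mathbb{R}^d$. A gauge function is a function $\phi:[0,\infty)\to[0,\infty)$ which is increasing, right-continuous, with $\phi(0)=0$ and $\phi(t)>0$ for $t>0$. The Hausdorff measure is $\mathcal{H}^\phi(E)=\lim_{\delta\to0}\inf\{\sum_i\phi(\operatorname{diam}U_i): E\subset\bigcup_i U_i,\ \operatorname{diam}U_i<\delta\}$. *)

(* Defs.v *)
From HB Require Import structures.
From mathcomp Require Import all_boot all_order all_algebra.
From mathcomp Require Import all_classical all_reals all_analysis.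
Set Implicit Arguments. Unset Strict Implicit. Unset Printing Implicit Defensive.
Import Order.TTheory GRing.Theory Num.Theory.
Import numFieldNormedType.Exports.
Local Open Scope classical_set_scope.
Local Open Scope ring_scope.

Section Defs.
Variables (R : realType) (d : nat).
Local Notation pt := 'rV[R]_d.

Definition edist (x y : pt) : R :=
  Num.sqrt (\sum_(i < d) (x 0 i - y 0 i) ^+ 2).

(* Euclidean diameter, with the convention diam set0 = 0 *)
Definition diam (U : set pt) : \bar R :=
  ereal_sup ([set 0%E] `|` [set (edist x y)%:E | x in U & y in U]).

(* gauge function phi : [0,oo) -> [0,oo) (values on negatives irrelevant) *)
Definition gauge (phi : R -> R) : Prop :=
  [/\ (forall s t, 0 <= s -> s <= t -> phi s <= phi t),
      (forall t, 0 <= t -> phi x @[x --> t^'+] --> phi t),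
      phi 0 = 0 &
      (forall t, 0 < t -> 0 < phi t)].

Definition hausdorff_delta (phi : R -> R) (delta : R) (E : set pt) : \bar R :=
  ereal_inf [set s | exists U : nat -> set pt,
     [/\ E `<=` \bigcup_n U n,
         (forall n, diam (U n) < delta%:E)%E &
         s = (\sum_(0 <= n <oo) (phi (fine (diam (U n))))%:E)%E]].

(* H^phi(E) = lim_{delta -> 0+} H^phi_delta(E); the limit of this
   nonincreasing function of delta is its supremum over delta > 0 *)
Definition hausdorff (phi : R -> R) (E : set pt) : \bar R :=
  ereal_sup [set hausdorff_delta phi delta E | delta in [set delta : R | 0 < delta]].

Definition box (a b : pt) : set pt := [set x | forall i, a 0 i <= x 0 i <= b 0 i].
Definition vol (a b : pt) : R := \prod_(i < d) (b 0 i - a 0 i).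

Definition lebesgue_outer (E : set pt) : \bar R :=
  ereal_inf [set s | exists a b : nat -> pt,
     [/\ (forall n i, a n 0 i <= b n 0 i),
         E `<=` \bigcup_n box (a n) (b n) &
         s = (\sum_(0 <= n <oo) (vol (a n) (b n))%:E)%E]].

Definition borel (A : set pt) : Prop :=
  <<s [set U : set pt | open U] >> A.

Definition Fsigma (B : set pt) : Prop :=
  exists F : nat -> set pt, (forall n, closed (F n)) /\ B = \bigcup_n F n.

Definition sumset (A B : set pt) : set pt :=
  [set z | exists a b, [/\ A a, B b & z = a + b]].

End Defs.

(* Main.v *)
(* A random-like closed null set B is built as an intersection of unions of small dyadic
   cubes, where at every stage each cube keeps about half of its volume. If A carries a
   mass distribution m with m(Q) <= phi(diam Q), then the mass of A that is still visible
   from x, i.e. of the a in A with x - a in the current approximation of B, is halved at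
   every stage up to a small error, except for few x: by Chebyshev it suffices to bound
   a second moment, where near pairs are controlled by the gauge, because phi(0+) = 0, and
   far pairs by making the selection oscillate at very different frequencies on
   different cubes. The choice does not depend on A. For most x visible mass survives
   all stages, and compactness gives x in A + B.
   The mass distribution exists for a compact subset of A of positive content, which is
   found by Choquet's argument: Borel sets are Suslin sets and the dyadic content is
   continuous along increasing unions. Working in the Cantor space of binary digits makes
   dyadic cubes clopen. The union of such sets B over a sequence of tolerances is
   invariant under integer translations, which settles all unit cubes at once. *)
Require Import Defs.
From HB Require Import structures.
From mathcomp Require Import all_boot all_order all_algebra.
From mathcomp Require Import all_classical all_reals all_analysis.
From mathcomp Require Import ring lra zify.
Import Order.TTheory GRing.Theory Num.Theory.
Import numFieldNormedType.Exports.
Local Open Scope classical_set_scope.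
Local Open Scope ring_scope.
Set Implicit Arguments.
Unset Strict Implicit.
Unset Printing Implicit Defensive.

(** * Outer measures defined by countable covers *)

(** Since B must serve every A, the selection at a stage is fixed before the mass distribution is
    known; its second moment bound therefore holds for all distributions below the gauge at once. It
    is proved on a finite cyclic grid, with differences taken modulo [2 ^ K], where correlations are
    estimated by shifting x, a bijection of the grid. A difference of reals determines the
    difference of grid points only up to a bounded error. Tolerating that error raises the retained
    share of volume from about 1/2 to at most 3/4, which still iterates to zero. The tolerance at
    stage k is [c / 4 ^ k.+1]. If mass [c / 4 ^ k] is visible, half of it minus the tolerance is
    again [c / 4 ^ k.+1], so induction gives mass at every finite stage. The exceptional x of stage
    k have measure at most the same number, and these sum to at most c. Thus c must lie below the
    content of the compact piece of A and also below the measure one is willing to lose. Neither is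
    known in advance, so a closed set is built for each [c = 1 / (j + 1)], and B is their union: an
    F-sigma set. *)

Section CoverCost.
Variables (R : realType) (X N : Type).
Variables (ok : set N) (cov : N -> set X) (w : N -> R).
Hypothesis w_ge0 : forall q, 0 <= w q.

(* Covers are sequences of [option N]: [None] is an empty piece of cost 0, so that
   finite covers and subcovers are again sequences. *)
Definition opt_cov (q : option N) : set X := if q is Some q then cov q else set0.
Definition opt_cost (q : option N) : \bar R := (if q is Some q then w q else 0)%:E.

Definition is_cover (u : nat -> option N) (E : set X) :=
  (forall n q, u n = Some q -> ok q) /\ E `<=` \bigcup_n opt_cov (u n).

Definition cover_cost (E : set X) : \bar R :=
  ereal_inf [set (\sum_(0 <= n <oo) opt_cost (u n))%E | u in [set u | is_cover u E]].

Lemma opt_cost_ge0 q : (0 <= opt_cost q)%E.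
Proof. by case: q => [q|] //=; rewrite lee_fin. Qed.

Lemma opt_cost_le_series u n : (opt_cost (u n) <= \sum_(0 <= k <oo) opt_cost (u k))%E.
Proof.
have u0 k : xpredT k -> (0 <= opt_cost (u k))%E by move=> _; exact: opt_cost_ge0.
rewrite (@nneseriesD1 R (fun k => opt_cost (u k)) n xpredT u0 isT) leeDl//.
by apply: nneseries_ge0 => k _ _; exact: opt_cost_ge0.
Qed.

Lemma cover_cost_ge0 E : (0 <= cover_cost E)%E.
Proof.
apply: le_ereal_inf_tmp => _ [u _ <-]; apply: nneseries_ge0 => n _ _; exact: opt_cost_ge0.
Qed.

Lemma cover_cost_le u E :
  is_cover u E -> (cover_cost E <= \sum_(0 <= n <oo) opt_cost (u n))%E.
Proof. by move=> uE; apply: ereal_inf_lbound; exists u. Qed.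

Lemma cover_cost_lt E x : (cover_cost E < x)%E ->
  exists2 u, is_cover u E & (\sum_(0 <= n <oo) opt_cost (u n) < x)%E.
Proof. by move=> /ereal_inf_lt[_ [u uE <-] ?]; exists u. Qed.

Lemma cover_cost_mono E F : E `<=` F -> (cover_cost E <= cover_cost F)%E.
Proof.
move=> EF; apply: ereal_inf_le_tmp => _ [u [uo uF] <-]; exists u => //; split => //.
exact: subset_trans EF uF.
Qed.

Lemma cover_cost_node q E : ok q -> E `<=` cov q -> (cover_cost E <= (w q)%:E)%E.
Proof.
move=> oq Eq; pose u (n : nat) := if n == 0%N then Some q else None.
apply: (@le_trans _ _ (\sum_(0 <= n <oo) opt_cost (u n))%E).
  apply: cover_cost_le; split=> [[|n] q'//= [<-]//|x /Eq qx]; by exists 0%N.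
rewrite (nneseries_split _ 1%N) => [|k _]; last exact: opt_cost_ge0.
rewrite eseries0 => [|i i1 _]; last by case: i i1.
by rewrite big_nat1 adde0.
Qed.

Lemma cover_cost_set0 : cover_cost set0 = 0%E.
Proof.
apply/eqP; rewrite eq_le cover_cost_ge0 andbT.
rewrite -[leRHS](@eseries0 R (fun=> 0%E) 0%N xpredT)//.
by apply: (cover_cost_le (u := fun=> None)); split => // x.
Qed.

Lemma cover_cost_bigcup (E : nat -> set X) :
  (cover_cost (\bigcup_n E n) <= \sum_(0 <= n <oo) cover_cost (E n))%E.
Proof.
have [[i ioo]|] := pselect (exists i, cover_cost (E i) = +oo%E).
  rewrite (eseries_pinfty _ _ ioo) ?leey// => n _.
  by rewrite -ltNye (lt_le_trans _ (cover_cost_ge0 _)).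
rewrite -forallNE => Eoo; apply/lee_addgt0Pr => e e0.
apply: (le_trans _ (epsilon_trick xpredT (fun n => cover_cost_ge0 (E n)) (ltW e0))).
have [u uP] : {u : nat -> nat -> option N & forall n, is_cover (u n) (E n) /\
    (\sum_(0 <= k <oo) opt_cost (u n k) <= cover_cost (E n) + (e / (2 ^ n.+1)%:R)%:E)%E}.
  apply: (@choice _ _ (fun n u => is_cover u (E n) /\
    (\sum_(0 <= k <oo) opt_cost (u k) <= cover_cost (E n) + (e / (2 ^ n.+1)%:R)%:E)%E)) => n.
  have fE : cover_cost (E n) \is a fin_num.
    by rewrite ge0_fin_numE ?cover_cost_ge0// ltey; apply/eqP/Eoo.
  have [|u uE ulE] := @cover_cost_lt (E n) (cover_cost (E n) + (e / (2 ^ n.+1)%:R)%:E)%E.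
    by rewrite lteDl// lte_fin divr_gt0// ltr0n expn_gt0.
  by exists u; split => //; exact: ltW.
have /card_esym/ppcard_eqP[f] := card_nat2.
pose v (n : nat) : option N := u (f n).1 (f n).2.
apply: (@le_trans _ _ (\sum_(0 <= n <oo) opt_cost (v n))%E).
  apply: cover_cost_le; split.
    by move=> n q; rewrite /v; exact: (uP _).1.1.
  move=> x [i _ Eix]; have [k _ kx] := (uP i).1.2 _ Eix.
  by exists (f^-1%FUN (i, k)) => //; rewrite /v invK ?inE.
apply: (@le_trans _ _ (\sum_(0 <= i <oo) \sum_(0 <= k <oo) opt_cost (u i k))%E); last first.
  apply: lee_nneseries => [i _ _|i _]; last exact: (uP i).2.
  by apply: nneseries_ge0 => k _ _; exact: opt_cost_ge0.
rewrite nneseries_esumT; last by move=> n; exact: opt_cost_ge0.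
rewrite nneseries_esumT; last first.
  by move=> i; apply: nneseries_ge0 => k _ _; exact: opt_cost_ge0.
rewrite [leRHS](_ : _ = \esum_(i in [set: nat]) \esum_(k in [set: nat]) opt_cost (u i k));
  last by apply: eq_esum => i _; rewrite nneseries_esumT// => k; apply: opt_cost_ge0.
rewrite esum_esum; last by move=> i k _ _; exact: opt_cost_ge0.
rewrite (reindex_esum setT (setT `*`` fun=> setT) f (fun p => opt_cost (u p.1 p.2)))//=.
rewrite (_ : _ `*`` _ = setT); first exact: bij.
by apply/seteqP; split.
Qed.

Lemma cover_costU E F : (cover_cost (E `|` F) <= cover_cost E + cover_cost F)%E.
Proof.
pose G (n : nat) : set X := if n is 0%N then E else if n is 1%N then F else set0.
have -> : E `|` F = \bigcup_n G n.
  apply/seteqP; split=> [x [Ex|Fx]|x [[|[|n]] _ //= Gx]]; [by exists 0%N|by exists 1%N|by left|by right].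
apply: (le_trans (cover_cost_bigcup _)).
rewrite (nneseries_split _ 2%N) => [|k _]; last exact: cover_cost_ge0.
rewrite eseries0 => [|[|[|i]]// _ _]; last exact: cover_cost_set0.
by rewrite adde0 !big_nat_recl// big_geq// adde0.
Qed.

Lemma cover_cost_seq (I : eqType) (r : seq I) (F : I -> set X) E :
  (forall x, E x -> exists2 i, i \in r & F i x) ->
  (cover_cost E <= \sum_(i <- r) cover_cost (F i))%E.
Proof.
elim: r E => [|i r IH] E EF.
  rewrite big_nil (_ : E = set0) ?cover_cost_set0//.
  by apply/seteqP; split=> // x /EF[].
rewrite big_cons; apply: (@le_trans _ _ (cover_cost (F i) + cover_cost (E `\` F i))%E).
  apply: le_trans (cover_costU _ _); apply: cover_cost_mono => x Ex.
  by have [|] := pselect (F i x); [left|right].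
apply: leeD => //; apply: IH => x [/EF[k]]; rewrite inE => /orP[/eqP ->//|kr Fk _].
by exists k.
Qed.

Lemma cover_cost_null (I : countType) (F : I -> set X) :
  (forall i, cover_cost (F i) = 0%E) -> cover_cost (\bigcup_i F i) = 0%E.
Proof.
move=> F0; apply/eqP; rewrite eq_le cover_cost_ge0 andbT.
pose G (n : nat) : set X := if unpickle n is Some i then F i else set0.
have FG : \bigcup_i F i `<=` \bigcup_n G n.
  by move=> x [i _ Fx]; exists (pickle i) => //; rewrite /G pickleK.
apply: (le_trans (cover_cost_mono FG)); apply: (le_trans (cover_cost_bigcup _)).
rewrite eseries0// => n _ _; rewrite /G.
by case: unpickle => [i|]; rewrite ?cover_cost_set0.
Qed.

End CoverCost.

(** * Content on the Cantor space of digit sequences *)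

Section Cylinders.
Variable D : finType.
Implicit Types (s t : seq D) (x y : nat -> D).

Definition cyl s : set (nat -> D) := [set x | mkseq x (size s) = s].

Lemma take_mkseq_le x m n : (m <= n)%N -> take m (mkseq x n) = mkseq x m.
Proof. by move=> mn; rewrite /mkseq -map_take take_iota (minn_idPl mn). Qed.

Lemma cyl_mkseq x n : cyl (mkseq x n) x.
Proof. by rewrite /cyl /= size_mkseq. Qed.

Lemma cyl_eq_take s t x : cyl s x -> cyl t x -> (size s <= size t)%N -> s = take (size s) t.
Proof. by rewrite /cyl /= => sx tx st; rewrite -tx take_mkseq_le. Qed.

Lemma cyl_rcons s a x : cyl (rcons s a) x <-> cyl s x /\ x (size s) = a.
Proof.
rewrite /cyl /= size_rcons mkseqS; split=> [/rcons_inj[]//|[-> ->]//].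
Qed.

Fixpoint lvl n : seq (seq D) :=
  if n is n'.+1 then [seq rcons s a | s <- lvl n', a <- enum D] else [:: [::]].

Lemma mem_lvl n s : (s \in lvl n) = (size s == n).
Proof.
elim: n s => [|n IH] s; first by rewrite inE; case: s.
apply/allpairsP/eqP => [[[t a] /= [tn _ ->]]|].
  by rewrite size_rcons; move: tn; rewrite IH => /eqP ->.
case/lastP: s => // s a; rewrite size_rcons => -[sn].
by exists (s, a); rewrite /= IH sn eqxx mem_enum.
Qed.

Lemma big_lvlS (V : nmodType) n (P : pred (seq D)) (F : seq D -> V) :
  \sum_(s <- lvl n.+1 | P s) F s = \sum_(s <- lvl n) \sum_(a | P (rcons s a)) F (rcons s a).
Proof.
rewrite /= big_mkcond big_allpairs_dep; apply: eq_bigr => s _.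
by rewrite [RHS]big_mkcond /= big_enum.
Qed.

Lemma lvl_uniq n : uniq (lvl n).
Proof.
elim: n => //= n IH; apply: allpairs_uniq => //; first exact: enum_uniq.
by move=> [s a] [t b] _ _ /= /rcons_inj[-> ->].
Qed.

End Cylinders.

Section Content.
Variables (R : realType) (D : finType) (psi : nat -> R).
Hypothesis psi_ge0 : forall n, 0 <= psi n.
Hypothesis psi_anti : forall m n, (m <= n)%N -> psi n <= psi m.
Implicit Types (s t : seq D) (x y : nat -> D) (E F : set (nat -> D)).

(** Content rather than measure: pieces of every size are allowed, so the root cylinder bounds it by
    [psi 0] and it can be treated as a real number. Nothing is lost for positivity, because a very
    cheap cover can only use small cylinders. *)
Definition enet_content : set (nat -> D) -> \bar R :=
  cover_cost setT (@cyl D) (fun s => psi (size s)).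
Definition net_content E : R := fine (enet_content E).

Let w_ge0 s : 0 <= psi (size s) := psi_ge0 _.
Notation ow := (opt_cost (fun s : seq D => psi (size s))).

Lemma enet_content_cyl E s : E `<=` cyl s -> (enet_content E <= (psi (size s))%:E)%E.
Proof. by move=> ?; apply: cover_cost_node. Qed.

Lemma enet_contentE E : enet_content E = (net_content E)%:E.
Proof.
rewrite fineK// ge0_fin_numE ?cover_cost_ge0//.
by rewrite (le_lt_trans (@enet_content_cyl E [::] _))// ?ltry.
Qed.

Lemma net_content_ge0 E : 0 <= net_content E.
Proof. by rewrite -lee_fin -enet_contentE cover_cost_ge0. Qed.

Lemma net_content_le_psi E s : E `<=` cyl s -> net_content E <= psi (size s).
Proof. by move=> ?; rewrite -lee_fin -enet_contentE enet_content_cyl. Qed.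

Lemma net_content_mono E F : E `<=` F -> net_content E <= net_content F.
Proof. by move=> ?; rewrite -lee_fin -!enet_contentE cover_cost_mono. Qed.

Lemma net_content0 : net_content set0 = 0.
Proof. by apply/EFin_inj; rewrite -enet_contentE /enet_content cover_cost_set0. Qed.

Lemma net_contentU E F : net_content (E `|` F) <= net_content E + net_content F.
Proof. by rewrite -lee_fin EFinD -!enet_contentE cover_costU. Qed.

Lemma net_content_seq (I : eqType) (r : seq I) (F : I -> set (nat -> D)) E :
  (forall x, E x -> exists2 i, i \in r & F i x) ->
  net_content E <= \sum_(i <- r) net_content (F i).
Proof.
move=> EF; rewrite -lee_fin -enet_contentE -sumEFin (eq_bigr (fun i => enet_content (F i))).
  exact: cover_cost_seq EF.
by move=> i _; rewrite enet_contentE.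
Qed.

Lemma net_content_bigcup (F : nat -> set (nat -> D)) (c : R) :
  (forall k, \sum_(0 <= n < k) net_content (F n) <= c) -> net_content (\bigcup_n F n) <= c.
Proof.
move=> Fc; rewrite -lee_fin -enet_contentE; apply: (le_trans (cover_cost_bigcup _ _ _ _)) => //.
apply: lime_le; first by apply: is_cvg_nneseries => n _ _; exact: cover_cost_ge0.
apply: nearW => k; rewrite (eq_bigr (fun n => (net_content (F n))%:E)); last first.
  by move=> n _; exact: enet_contentE.
by rewrite sumEFin lee_fin.
Qed.

Lemma net_content_cover u E : is_cover setT (@cyl D) u E ->
  ((net_content E)%:E <= \sum_(0 <= n <oo) ow (u n))%E.
Proof. by move=> uE; rewrite -enet_contentE; exact: cover_cost_le. Qed.

Lemma net_content_lt E c : net_content E < c ->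
  exists2 u, is_cover setT (@cyl D) u E & (\sum_(0 <= n <oo) ow (u n) < c%:E)%E.
Proof. by rewrite -lte_fin -enet_contentE => /cover_cost_lt. Qed.

Lemma net_content_subadd_children E s :
  net_content (E `&` cyl s) <= \sum_a net_content (E `&` cyl (rcons s a)).
Proof.
rewrite -big_enum; apply: net_content_seq => x [Ex sx]; exists (x (size s)); first by rewrite mem_enum.
by split=> //; apply/cyl_rcons.
Qed.

Let ow_ge0 q : (0 <= ow q)%E. Proof. exact: opt_cost_ge0. Qed.

(** A cover cheaper than [psi (size s)] uses only cylinders strictly longer than [s], since [psi] is
    nonincreasing. Each of these lies in at most one child of [s], so the cover splits into covers
    of the children without raising the total cost. *)
Lemma net_content_children E s : net_content (E `&` cyl s) < psi (size s) ->
  \sum_a net_content (E `&` cyl (rcons s a)) <= net_content (E `&` cyl s).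
Proof.
move=> Es; rewrite leNgt; apply/negP => lt.
have /net_content_lt[u [_ uE]] : net_content (E `&` cyl s) <
    Num.min (psi (size s)) (\sum_a net_content (E `&` cyl (rcons s a))).
  by rewrite lt_min Es lt.
rewrite EFin_min lt_min => /andP[us]; apply/negP; rewrite -leNgt.
have short n t : u n = Some t -> (size s < size t)%N.
  move=> unt; rewrite ltnNge; apply/negP => ts; move: us; apply/negP; rewrite -leNgt.
  by apply: (le_trans _ (opt_cost_le_series w_ge0 u n)); rewrite unt /= lee_fin psi_anti.
pose ua a n := if u n is Some t then if prefix (rcons s a) t then Some t else None else None.
have uaP a : is_cover setT (@cyl D) (ua a) (E `&` cyl (rcons s a)).
  split=> // x [Ex sax]; have [sx _] := (cyl_rcons _ _ _).1 sax.
  have [n _ unx] := uE x (conj Ex sx); exists n => //; rewrite /ua.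
  move: unx; case unt : (u n) => [t|]//= tx.
  have := short _ _ unt; rewrite -(size_rcons s a) => st.
  have -> // : prefix (rcons s a) t.
  by rewrite prefixE -(cyl_eq_take sax tx st).
rewrite -sumEFin; apply: (@le_trans _ _ (\sum_a \sum_(0 <= n <oo) ow (ua a n))%E).
  by apply: lee_sum => a _; exact: net_content_cover.
rewrite -nneseries_sum; last by move=> *; exact: ow_ge0.
apply: lee_nneseries => [n _ _|n _]; first by apply: sume_ge0 => a _; exact: ow_ge0.
rewrite /ua; case unt : (u n) => [t|]; last by rewrite big1.
have [a pa|np] := pickP (fun a => prefix (rcons s a) t); last first.
  by rewrite big1 ?ow_ge0// => a _; rewrite np.
rewrite (bigD1 a)//= pa big1 ?adde0// => b /negP ba.
case: ifPn => // pb; exfalso; apply: ba.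
move: pa pb; rewrite !prefixE => /eqP pa; rewrite !size_rcons in pa *.
by rewrite pa => /eqP/rcons_inj[->].
Qed.

(* Stopping the descent at the cubes where the content of the sets [A m] eventually
   reaches the fraction [1 - e] of the gauge covers everything but a set on which
   every cover can be improved by that factor, hence of content zero. *)
Section IncreasingUnion.
Variables (A : nat -> set (nat -> D)) (c : R).
Hypothesis A_homo : forall m n, (m <= n)%N -> A m `<=` A n.
Hypothesis A_le : forall m, net_content (A m) <= c.

Let L s := sup (range (fun m => net_content (A m `&` cyl s))).

Let L_has_sup s : has_sup (range (fun m => net_content (A m `&` cyl s))).
Proof.
split; first by exists (net_content (A 0%N `&` cyl s)); exists 0%N.
by exists (psi (size s)) => _ [m _ <-]; apply: net_content_le_psi => x [].
Qed.

Let L_ge m s : net_content (A m `&` cyl s) <= L s.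
Proof. by apply: ub_le_sup; [exact: (L_has_sup s).2|exists m]. Qed.

Let L_le s z : (forall m, net_content (A m `&` cyl s) <= z) -> L s <= z.
Proof.
move=> Az; apply: ge_sup; first exact: (L_has_sup s).1.
by move=> _ [m _ <-].
Qed.

Let L_ge0 s : 0 <= L s.
Proof. exact: le_trans (net_content_ge0 _) (L_ge 0 s). Qed.

(** There are finitely many children, so a single index [M] nearly attains all their suprema, and
    the inequality for [A M] passes to the limit. *)
Let L_children s : L s < psi (size s) -> \sum_a L (rcons s a) <= L s.
Proof.
move=> Ls; apply/ler_addgt0Pr => e e0.
pose e' := e / (#|D|.+1)%:R.
have e'0 : 0 < e' by rewrite divr_gt0.
have [m mP] : {m : D -> nat & forall a, L (rcons s a) - e' < net_content (A (m a) `&` cyl (rcons s a))}.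
  apply: (@choice _ _ (fun a m => L (rcons s a) - e' < net_content (A m `&` cyl (rcons s a)))) => a.
  by have [_ [m _ <-] ?] := sup_adherent e'0 (L_has_sup (rcons s a)); exists m.
pose M := (\max_a m a)%N.
apply: (@le_trans _ _ (\sum_a (net_content (A M `&` cyl (rcons s a)) + e'))).
  apply: ler_sum => a _; rewrite -lerBlDr; apply: le_trans (ltW (mP a)) _.
  apply: net_content_mono => x [Ax ax]; split=> //; apply: A_homo Ax.
  exact: leq_bigmax.
rewrite big_split /= sumr_const; apply: lerD.
  apply: (le_trans (net_content_children _)) => //; exact: le_lt_trans (L_ge M s) Ls.
rewrite -mulr_natr /e' -mulrA; apply: ler_piMr; first exact: ltW.
by rewrite mulrC ler_pdivrMr ?mul1r ?ler_nat ?ltr0n.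
Qed.

Section Threshold.
Variable e : R.
Hypothesis e01 : 0 < e < 1.

Let heavy s := (1 - e) * psi (size s) <= L s.
Let live s := all (fun i => ~~ heavy (take i s)) (iota 0 (size s)).

Let live_rcons s a : live (rcons s a) = live s && ~~ heavy s.
Proof.
rewrite /live size_rcons -addn1 iotaD all_cat /= add0n andbT -cats1 take_size_cat//.
congr (_ && _); apply: eq_in_all => i; rewrite mem_iota add0n => /andP[_ si].
by rewrite takel_cat// ltnW.
Qed.

Let first s := live s && heavy s.

(** Invariant of the descent: a heavy live cylinder is stopped and charged at most its [L], while
    any other live one hands its [L] down to its children. The total never exceeds the value at the
    root. *)
Let stopped_mass k :
  \sum_(0 <= n < k) \sum_(s <- lvl D n | first s) (1 - e) * psi (size s)
    + \sum_(s <- lvl D k | live s) L s <= L [::].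
Proof.
elim: k => [|k IH]; first by rewrite big_geq// add0r big_cons big_nil /= addr0.
rewrite big_nat_recr//= -addrA; apply: le_trans IH; rewrite lerD2l.
rewrite big_lvlS (bigID heavy live) /=.
rewrite (eq_bigl first) //; apply: lerD.
  by apply: ler_sum => s /andP[].
rewrite [leRHS]big_mkcond /= ; apply: ler_sum => s _.
case: ifPn => ls; last by rewrite big_pred0// => a; rewrite live_rcons (negbTE ls).
rewrite (eq_bigl xpredT) => [|a]; last by rewrite live_rcons ls.
apply: L_children; move/andP: ls => [_]; rewrite /heavy -ltNge => /lt_le_trans; apply.
by rewrite ler_piMl//; have [? ?] := andP e01; lra.
Qed.

Let net_content_stopped : net_content (\bigcup_n [set x | first (mkseq x n)]) <= L [::] / (1 - e).
Proof.
have e1 : 0 < 1 - e by have [? ?] := andP e01; lra.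
apply: net_content_bigcup => k; rewrite ler_pdivlMr// mulrC mulr_sumr.
apply: le_trans (stopped_mass k); rewrite ler_wpDr//; first exact: sumr_ge0.
apply: ler_sum => n _; rewrite -mulr_sumr ler_pM2l// -big_filter.
apply: (@le_trans _ _ (\sum_(s <- [seq s <- lvl D n | first s]) net_content (cyl s))).
  apply: net_content_seq => x fx; exists (mkseq x n); last exact: cyl_mkseq.
  by rewrite mem_filter fx mem_lvl size_mkseq /=.
by apply: ler_sum => s _; exact: net_content_le_psi.
Qed.

Let residue m := A m `&` [set x | forall n, ~~ heavy (mkseq x n)].

Let net_content_residue m : net_content (residue m) = 0.
Proof.
have [e0 e1] := andP e01.
apply/eqP; rewrite eq_le net_content_ge0 andbT; apply/ler_addgt0Pr => h h0; rewrite add0r.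
(* The slack [e * h] is chosen so that [z <= (1 - e) * (z + e * h)] gives [z <= (1 - e) * h], hence
   [z <= h]. *)
have h'0 : 0 < e * h by rewrite mulr_gt0.
have /net_content_lt[u [_ uE] uc] : net_content (residue m) < net_content (residue m) + e * h.
  by rewrite ltrDl.
have : net_content (residue m) <= (1 - e) * (net_content (residue m) + e * h).
  have sub : residue m `<=` \bigcup_n (residue m `&` opt_cov (@cyl D) (u n)).
    by move=> x Rx; have [n _ un] := uE _ Rx; exists n.
  apply: (le_trans (net_content_mono sub)); apply: net_content_bigcup => k.
  have : (\sum_(0 <= n < k) ow (u n) < (net_content (residue m) + e * h)%:E)%E.
    by apply: le_lt_trans uc; exact: nneseries_lim_ge.
  rewrite /opt_cost sumEFin lte_fin => /ltW kc.
  apply: le_trans (ler_wpM2l _ kc); last by lra.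
  rewrite mulr_sumr; apply: ler_sum => n _; case un : (u n) => [s|] /=; last first.
    by rewrite setI0 net_content0 mulr0.
  have [[x [[Ax nx] sx]]|/forallNP nx] := pselect (exists x, (residue m `&` cyl s) x).
    apply: (@le_trans _ _ (L s)).
      apply: le_trans (L_ge m s); apply: net_content_mono => y [[]] //.
    by have := nx (size s); rewrite sx /heavy -ltNge => /ltW.
  rewrite (_ : residue m `&` cyl s = set0) ?net_content0 ?mulr_ge0//; first by lra.
  by apply/seteqP; split=> // x /nx.
have := net_content_ge0 (residue m); nra.
Qed.

Lemma net_content_bigcup_threshold : net_content (\bigcup_m A m) <= c / (1 - e).
Proof.
have [e0 e1] := andP e01.
pose S := \bigcup_n [set x | first (mkseq x n)].
have AS : \bigcup_m A m `<=` S `|` \bigcup_m residue m.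
  move=> x [m _ Amx]; have [[n hn]|/forallNP nx] := pselect (exists n, heavy (mkseq x n)).
    left; exists (ex_minn (ex_intro (fun n => heavy (mkseq x n)) n hn)) => //=.
    case: ex_minnP => k hk kmin; rewrite /first hk andbT.
    apply/allP => i; rewrite size_mkseq mem_iota add0n => /andP[_ ik].
    rewrite take_mkseq_le; last exact: ltnW.
    by apply/negP => hi; have := kmin _ hi; rewrite leqNgt ik.
  right; exists m; first by [].
  by split; [exact: Amx|move=> n; apply/negP; exact: nx].
apply: (le_trans (net_content_mono AS)); apply: (le_trans (net_contentU _ _)).
rewrite -[leRHS]addr0; apply: lerD.
  apply: (le_trans net_content_stopped); rewrite ler_pM2r ?invr_gt0//; last by lra.
  by apply: L_le => m; apply: le_trans (A_le m); apply: net_content_mono => x [].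
by apply: net_content_bigcup => k; rewrite big1// => m _; exact: net_content_residue.
Qed.

End Threshold.

Lemma net_content_increasing : net_content (\bigcup_m A m) <= c.
Proof.
have c0 : 0 <= c by apply: le_trans (A_le 0); exact: net_content_ge0.
apply/ler_addgt0Pr => h h0.
(* With this [e], [c / (1 - e) = c + c * h / (c + 1)], which is at most [c + h]; the summand 1
   covers the case [c = 0]. *)
pose e := h / (c + h + 1).
have e01 : 0 < e < 1.
  by rewrite divr_gt0 ?ltr_pdivrMr ?mul1r//=; lra.
apply: (le_trans (net_content_bigcup_threshold e01)).
have ch : 0 < c + h + 1 by lra.
have -> : 1 - e = (c + 1) / (c + h + 1) by rewrite /e; field; lra.
rewrite invf_div mulrA ler_pdivrMr; nra.
Qed.

End IncreasingUnion.

End Content.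

(** * Capacitability of Suslin sets and mass distributions *)

Definition agree (T : Type) n (x y : nat -> T) := forall i, (i < n)%N -> x i = y i.

Lemma agree_mkseq (T : eqType) n (x y : nat -> T) : agree n x y <-> mkseq x n = mkseq y n.
Proof.
split=> [xy|xy i ni].
  by apply: (@eq_from_nth _ (x 0%N)); rewrite !size_mkseq// => i ni; rewrite !nth_mkseq// xy.
by rewrite -(nth_mkseq (x 0%N) x ni) -(nth_mkseq (x 0%N) y ni) xy.
Qed.

(** * Compactness through an ultrafilter on the indices *)

Section UltraLimit.
Variables (U : set_system nat).
Hypothesis UU : UltraFilter U.
Let PU : ProperFilter U := @ultra_proper _ _ UU.
Hypothesis Uoo : forall n, U [set k | (n <= k)%N].

Lemma ultra_const (T : eqType) (z : nat -> T) (r : seq T) :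
  U [set k | z k \in r] -> exists v, U [set k | z k = v].
Proof.
elim: r => [|v r IH] Ur.
  by exfalso; have [k] := filter_ex Ur.
have [Uv|Unv] := in_ultra_setVsetC [set k | z k = v] UU; first by exists v.
apply: IH; apply: filterS2 Ur Unv => k /=; rewrite inE => /orP[/eqP//|//].
Qed.

(** Each coordinate ranges over finitely many values, so the ultrafilter selects one of them. All
    coordinates are treated with the same ultrafilter, which replaces the extraction of diagonal
    subsequences. *)
Lemma ultra_lim (T : eqType) (z : nat -> nat -> T) :
  (forall i, exists r : seq T, U [set k | z k i \in r]) ->
  exists x, forall n, U [set k | agree n (z k) x].
Proof.
move=> zr; have [x xP] : {x : nat -> T & forall i, U [set k | z k i = x i]}.
  apply: (@choice _ _ (fun i v => U [set k | z k i = v])) => i.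
  by have [r] := zr i; exact: ultra_const.
exists x; elim=> [|n IH]; first by apply: filterS (Uoo 0) => k _ i.
apply: filterS2 IH (xP n) => k /= kn knx i; rewrite ltnS leq_eqVlt => /orP[/eqP ->//|]; exact: kn.
Qed.

End UltraLimit.

Lemma exists_ultra : exists2 U : set_system nat, UltraFilter U & forall n, U [set k | (n <= k)%N].
Proof.
have [U [UU ooU]] := @ultraFilterLemma nat \oo _.
by exists U => // n; apply: ooU; exists n.
Qed.

Section Suslin.
Variable D : finType.
Implicit Types (x y : nat -> D) (A K : set (nat -> D)).

Definition prefix_closed A := forall x, (forall n, exists2 y, agree n x y & A y) -> A x.

Definition prefix_closed2 (P : (nat -> nat) -> (nat -> D) -> Prop) :=
  forall u x, (forall n, exists v y, [/\ agree n u v, agree n x y & P v y]) -> P u x.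

(** Analytic sets as projections of closed subsets of Baire space times Cantor space; closedness in
    the product topology is expressed through finite prefixes. *)
Definition suslin A := exists2 P, prefix_closed2 P & A = [set x | exists u, P u x].

Lemma suslin_closed A : prefix_closed A -> suslin A.
Proof.
move=> Acl; exists (fun _ => A).
  move=> u x ux; apply: Acl => n; have [v [y [_ xy Ay]]] := ux n; by exists y.
by apply/seteqP; split=> [x Ax|x []//]; exists id.
Qed.

(** The witness [u 0] is the length of a prefix of [x] whose whole cylinder lies in [A]; the
    condition reads only finitely many digits. *)
Lemma suslin_open A : prefix_closed (~` A) -> suslin A.
Proof.
move=> Acl; exists (fun u x => forall y, agree (u 0%N) x y -> A y).
  move=> u x ux y xy; have [v [z [uv xz vz]]] := ux (u 0%N).+1.
  apply: vz => i; rewrite -(uv 0%N)// => iu; rewrite -xy// xz//; exact: ltnW.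
apply/seteqP; split=> x /=; last by move=> [u]; apply.
move=> Ax; apply: contrapT => /forallNP nx.
apply: (Acl x) => // n; have := nx (fun=> n) => /existsNP[y /not_implyP[xy nAy]].
by exists y.
Qed.

Lemma suslin_bigcup (A : nat -> set (nat -> D)) :
  (forall i, suslin (A i)) -> suslin (\bigcup_i A i).
Proof.
move=> sA; have [P PA] : {P : nat -> (nat -> nat) -> (nat -> D) -> Prop &
    forall i, prefix_closed2 (P i) /\ A i = [set x | exists u, P i u x]}.
  apply: (@choice _ _ (fun i P => prefix_closed2 P /\ A i = [set x | exists u, P u x])) => i.
  by have [P] := sA i; exists P.
(* The first entry names the member of the union, the rest is the witness for it. *)
exists (fun u x => P (u 0%N) (fun j => u j.+1) x).
  move=> u x ux; apply: (PA _).1 => n; have [v [y [uv xy vy]]] := ux n.+1.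
  exists (fun j => v j.+1), y; split; last by rewrite (uv 0%N).
  - by move=> i ni; exact: uv.
  - by move=> i ni; apply: xy; exact: ltnW.
apply/seteqP; split=> [x [i _]|x [u ux]].
  by rewrite (PA i).2 => -[u ux]; exists (fun j => if j is j'.+1 then u j' else i).
by exists (u 0%N) => //; rewrite (PA _).2; exists (fun j => u j.+1).
Qed.

Lemma suslin_bigcap (A : nat -> set (nat -> D)) :
  (forall i, suslin (A i)) -> suslin (\bigcap_i A i).
Proof.
move=> sA; have [P PA] : {P : nat -> (nat -> nat) -> (nat -> D) -> Prop &
    forall i, prefix_closed2 (P i) /\ A i = [set x | exists u, P i u x]}.
  apply: (@choice _ _ (fun i P => prefix_closed2 P /\ A i = [set x | exists u, P u x])) => i.
  by have [P] := sA i; exists P.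
exists (fun u x => forall i, P i (fun j => u (pickle (i, j))) x).
  move=> u x ux i; apply: (PA _).1 => n.
  (* Witnesses for all [i] are interleaved through [pickle]; a prefix of length [N] contains the
     first [n] entries of the [i]-th one. *)
  pose N := (n + \max_(j < n) (pickle (i, val j)).+1)%N.
  have [v [y [uv xy vy]]] := ux N.
  exists (fun j => v (pickle (i, j))), y; split => //.
  - move=> j jn; apply: uv; apply: leq_trans (leq_addl _ _).
    exact: (leq_bigmax (Ordinal jn)).
  - by move=> j jn; apply: xy; apply: leq_trans jn (leq_addr _ _).
apply/seteqP; split=> [x Ax|x [u ux] i _]; last first.
  by rewrite (PA i).2; exists (fun j => u (pickle (i, j))).
have [f fP] : {f : nat -> nat -> nat & forall i, P i (f i) x}.
  by apply: (@choice _ _ (fun i u => P i u x)) => i; have := Ax i I; rewrite (PA i).2.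
exists (fun k => if (unpickle k : option (nat * nat)) is Some ij then f ij.1 ij.2 else 0%N) => i.
by rewrite (_ : (fun j => _) = f i)//; apply/funext => j; rewrite pickleK.
Qed.

End Suslin.

Section Capacity.
Variables (R : realType) (D : finType) (psi : nat -> R).
Hypothesis psi_ge0 : forall n, 0 <= psi n.
Hypothesis psi_anti : forall m n, (m <= n)%N -> psi n <= psi m.

(* The bounds [b] on the witnessing sequence are chosen one coordinate at a time, keeping
   the content above [c]; the set of points with a witness below [b] is then compact, and
   since cylinders are clopen any cover of it already covers one of the finite stages. *)
Lemma suslin_capacitable (A : set (nat -> D)) c : suslin A -> c < net_content psi A ->
  exists K, [/\ K `<=` A, prefix_closed K & c <= net_content psi K].
Proof.
move=> [P Pcl AP] cA.
pose E (l : seq nat) := [set x | exists2 u, P u x & forall i, (i < size l)%N -> (u i <= nth 0 l i)%N].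
have [f fP] : {f : seq nat -> nat & forall l, c < net_content psi (E l) -> c < net_content psi (E (rcons l (f l)))}.
  apply: (@choice _ _ (fun l m => c < net_content psi (E l) -> c < net_content psi (E (rcons l m)))) => l.
  have [cl|ncl] := pselect (c < net_content psi (E l)); last by exists 0%N.
  apply: contrapT => /forallNP nm.
  have : net_content psi (\bigcup_m E (rcons l m)) <= c.
    apply: net_content_increasing => //.
      move=> m n mn x [u ux ul]; exists u => // i; rewrite size_rcons => il.
      have := ul i; rewrite size_rcons !nth_rcons => /(_ il).
      by case: ltnP => // _; case: eqP => // _ /leq_trans; apply.
    by move=> m; rewrite leNgt; apply/negP => cm; apply: (nm m).
  apply/negP; rewrite -ltNge; apply: lt_le_trans cl _; apply: net_content_mono => // x [u ux ul].
  exists (u (size l)) => //; exists u => // i; rewrite size_rcons ltnS nth_rcons => il.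
  case: ltnP => [|li]; first exact: ul.
  have -> : i = size l by apply/eqP; rewrite eqn_leq il li.
  by rewrite eqxx.
pose b i := f (iter i (fun l => rcons l (f l)) [::]).
have bE k : iter k (fun l => rcons l (f l)) [::] = mkseq b k.
  by elim: k => //= k IH; rewrite mkseqS -IH.
have cb k : c < net_content psi (E (mkseq b k)).
  elim: k => [|k IH]; last by rewrite mkseqS /b bE; exact: fP.
  by rewrite (_ : E _ = A)// AP; apply/seteqP; split=> x [u]; exists u.
pose K := [set x | exists2 u, P u x & forall i, (u i <= b i)%N].
have [U UU Uoo] := exists_ultra.
have PU : ProperFilter U := @ultra_proper _ _ UU.
(* The [k]-th witness need only be bounded in its first [k] coordinates, because the limit sees each
   coordinate along large [k]. This serves both the closedness of [K] and the passage from the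
   finite stages to [K]. *)
have key (u : nat -> nat -> nat) (x : nat -> nat -> D) :
    (forall k, P (u k) (x k)) -> (forall k i, (i < k)%N -> (u k i <= b i)%N) ->
    exists2 y, K y & forall n, U [set k | agree n (x k) y].
  move=> ux ub.
  have [v uv] : exists v, forall n, U [set k | agree n (u k) v].
    apply: ultra_lim => // i; exists (iota 0 (b i).+1); apply: filterS (Uoo i.+1) => k ik.
    by change (u k i \in iota 0 (b i).+1); rewrite mem_iota add0n ltnS ub.
  have [y xy] : exists v, forall n, U [set k | agree n (x k) v].
    apply: ultra_lim => // i; exists (enum D); apply: filterS (Uoo 0%N) => k _.
    by change (x k i \in enum D); rewrite mem_enum.
  exists y => //; exists v.
    apply: Pcl => n; have [k [/= kv ky]] := filter_ex (filterI (uv n) (xy n)).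
    by exists (u k), (x k); split => // i ni; rewrite ?kv ?ky.
  move=> i; have [k [/= kv ik]] := filter_ex (filterI (uv i.+1) (Uoo i.+1)).
  by rewrite -kv// ub.
exists K; split.
- by move=> x [u ux _]; rewrite AP; exists u.
- move=> x xK; have [y yP] : {y : nat -> nat -> D & forall n, agree n x (y n) /\ K (y n)}.
    by apply: (@choice _ _ (fun n y => agree n x y /\ K y)) => n; have [y] := xK n; exists y.
  have [u uP] : {u : nat -> nat -> nat & forall n, P (u n) (y n) /\ forall i, (u n i <= b i)%N}.
    apply: (@choice _ _ (fun n u => P u (y n) /\ forall i, (u i <= b i)%N)) => n.
    by have [_ [u]] := yP n; exists u.
  have [z Kz yz] := key u y (fun k => (uP k).1) (fun k i _ => (uP k).2 i).
  rewrite (_ : x = z)//; apply/funext => i.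
  have [k [/= kz ik]] := filter_ex (filterI (yz i.+1) (Uoo i.+1)).
  by rewrite -kz// (yP k).1.
- rewrite leNgt; apply/negP => /net_content_lt-/(_ psi_ge0)[u [_ uK] uc].
  have /choice[z zP] : forall k, exists z : (nat -> nat) * (nat -> D), [/\ P z.1 z.2,
      forall i, (i < k)%N -> (z.1 i <= b i)%N & ~ (\bigcup_n opt_cov (@cyl D) (u n)) z.2].
    move=> k; apply: contrapT => /forallNP nz.
    have := cb k; apply/negP; rewrite -leNgt -lee_fin; apply: le_trans (ltW uc).
    apply: net_content_cover => //; split=> // x [v vx vb]; apply: contrapT => nux.
    apply: (nz (v, x)); split=> // i ik; have := vb i; rewrite size_mkseq => /(_ ik).
    by rewrite nth_mkseq.
  have [||y Ky zy] := key (fun k => (z k).1) (fun k => (z k).2).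
  - by move=> k; have [] := zP k.
  - by move=> k; have [] := zP k.
  have [n _] := uK _ Ky; case un : (u n) => [t|]//= ty.
  have [k /= kt] := filter_ex (zy (size t)); have [_ _] := zP k; apply.
  by exists n => //; rewrite un /= /cyl /= (iffLR (agree_mkseq _ _ _) kt).
Qed.

Section Mass.
Variables (K : set (nat -> D)) (c : R).
Hypotheses (c_ge0 : 0 <= c) (cK : c <= net_content psi K).

Let q s := net_content psi (K `&` cyl s).

(* Mass is handed down to the children in proportion to their contents; subadditivity of
   the content keeps it below the content. When all children have content 0 the quotient
   is 0, and so is the mass of the parent. *)
Fixpoint mass_rev (r : seq D) : R :=
  if r is a :: r' then q (rev r) * mass_rev r' / \sum_b q (rev (b :: r')) else c.
Definition mass s := mass_rev (rev s).

Let massS s a : mass (rcons s a) = q (rcons s a) * mass s / \sum_b q (rcons s b).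
Proof.
rewrite /mass rev_rcons /= rev_cons revK; congr (_ / _).
by apply: eq_bigr => b _; rewrite rev_cons revK.
Qed.

Lemma mass_nil : mass [::] = c. Proof. by []. Qed.

Let q_ge0 s : 0 <= q s. Proof. exact: net_content_ge0. Qed.

Lemma mass_ge0 s : 0 <= mass s.
Proof.
elim/last_ind: s => // s a IH; rewrite massS divr_ge0 ?mulr_ge0//.
exact: sumr_ge0.
Qed.

Let mass_le_q s : mass s <= q s.
Proof.
elim/last_ind: s => [|s a IH].
  by rewrite mass_nil /q (_ : _ `&` _ = K)//; apply/seteqP; split=> [x []|x Kx].
have S0 : 0 <= \sum_b q (rcons s b) by exact: sumr_ge0.
rewrite massS; have [->|Sn0] := eqVneq (\sum_b q (rcons s b)) 0.
  by rewrite invr0 mulr0.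
rewrite ler_pdivrMr ?lt_def ?Sn0//; apply: ler_wpM2l => //.
apply: (le_trans IH); exact: net_content_subadd_children.
Qed.

Lemma mass_children s : mass s = \sum_a mass (rcons s a).
Proof.
have [S0|Sn0] := eqVneq (\sum_b q (rcons s b)) 0; last first.
  rewrite (eq_bigr (fun a => q (rcons s a) * (mass s / \sum_b q (rcons s b)))) => [|a _].
    by rewrite -mulr_suml mulrC mulfVK.
  by rewrite massS mulrA.
have m0 t : q t <= 0 -> mass t = 0.
  by move=> t0; apply/eqP; rewrite eq_le mass_ge0 andbT (le_trans (mass_le_q t)).
rewrite m0; last by rewrite -S0 /q net_content_subadd_children.
rewrite big1// => a _; apply: m0; rewrite -S0 (bigD1 a)//= lerDl; exact: sumr_ge0.
Qed.

Lemma mass_le s : mass s <= psi (size s).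
Proof. by apply: (le_trans (mass_le_q s)); apply: net_content_le_psi => // x []. Qed.

Lemma mass_gt0 s : 0 < mass s -> exists2 x, K x & cyl s x.
Proof.
move=> s0; apply: contrapT => /forall2NP nx.
have := lt_le_trans s0 (mass_le_q s); rewrite /q (_ : _ `&` _ = set0) ?net_content0 ?ltxx//.
by apply/seteqP; split=> // x [Kx sx]; have [] := nx x.
Qed.

End Mass.

End Capacity.

(** * An oscillating selection rule with small correlations *)

Section NatArithmetic.
Local Open Scope nat_scope.

Lemma digits_mod K p m a b : (p + m <= K)%N -> a = b %[mod 2 ^ K] ->
  (a %/ 2 ^ p) %% 2 ^ m = (b %/ 2 ^ p) %% 2 ^ m.
Proof.
move=> pmK ab.
have H c : (c %/ 2 ^ p) %% 2 ^ m = ((c %% 2 ^ K) %/ 2 ^ p) %% 2 ^ m.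
  rewrite {1}(divn_eq c (2 ^ K)).
  have -> : (2 ^ K = 2 ^ (K - (p + m)) * 2 ^ m * 2 ^ p)%N.
    by rewrite -!expnD; congr (_ ^ _)%N; lia.
  by rewrite mulnA divnMDl ?expn_gt0// mulnA modnMDl.
by rewrite H ab -H.
Qed.

Lemma divn_nocarry W V z t : (W %| V)%N -> (z %% W + t < W)%N -> ((z + t) %/ V = z %/ V)%N.
Proof.
move=> /dvdnP[k ->] zt; have W0 : (0 < W)%N by lia.
rewrite mulnC !divnMA; congr (_ %/ _)%N.
by rewrite {1}(divn_eq z W) -addnA divnMDl// [X in (_ + X)%N]divn_small ?addn0.
Qed.

Lemma sum_mod_shift W a (F : nat -> nat) :
  \sum_(0 <= x < W) F ((x + a) %% W)%N = \sum_(0 <= x < W) F x.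
Proof.
elim: a => [|a <-].
  by apply: eq_big_nat => x /andP[_ xW]; rewrite addn0 modn_small.
case: W => [|W]; first by rewrite !big_geq.
rewrite [LHS]big_nat_recr//= [RHS]big_nat_recl//= addnC; congr (_ + _)%N.
  by rewrite addnS -addSn modnDl add0n.
by apply: eq_bigr => x _; rewrite addnS addSn.
Qed.

Lemma sum_carry k W t a : (t <= W)%N ->
  \sum_(0 <= x < k * W) (W - t <= (x + a) %% W)%N = (k * t)%N.
Proof.
move=> tW; rewrite big_nat_mul.
rewrite (eq_bigr (fun=> t)) => [|i _]; last first.
  rewrite -{1}[(i * W)%N]add0n big_addn mulSn addnK.
  transitivity (\sum_(0 <= x < W) (W - t <= x)%N); last first.
    rewrite (@big_cat_nat _ _ _ (W - t)) ?leq_subr//=.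
    rewrite big_nat_cond big1 ?add0n => [|j /andP[/andP[_ jW] _]]; last first.
      by rewrite leqNgt jW.
    rewrite big_nat_cond (eq_bigr (fun=> 1%N)) => [|j /andP[/andP[-> _] _]//].
    by rewrite -big_nat_cond sum_nat_const_nat muln1; lia.
  rewrite -[RHS](sum_mod_shift _ a); apply: eq_bigr => x _.
  by congr (nat_of_bool (_ <= _)%N); rewrite addnAC addnC modnMDl.
by rewrite big_mkord sum_nat_const card_ord.
Qed.

End NatArithmetic.

Section Grid.
Local Open Scope nat_scope.
Variables (d n : nat).
Hypothesis n_gt0 : (0 < n)%N.
Notation G := {ffun 'I_d -> 'I_n}.

Lemma card_coord_mul (i : 'I_d) (P : pred nat) :
  (#|[pred x : G | P (x i)]| * n = n ^ d * \sum_(0 <= j < n) P j)%N.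
Proof.
pose F (k : 'I_d) (j : 'I_n) : nat := if k == i then nat_of_bool (P j) else 1.
have -> : #|[pred x : G | P (x i)]| = (\sum_(x : G) \prod_k F k (x k))%N.
  rewrite -sum1_card big_mkcond /=; apply: eq_bigr => x _.
  rewrite (bigD1 i)//= /F eqxx big1 ?muln1; first by rewrite inE /=; case: (P (x i)).
  by move=> k /negbTE ->.
rewrite -bigA_distr_bigA (bigD1 i)//= /F eqxx.
rewrite [X in _ * X * _](eq_bigr (fun=> n)); last by move=> k /negbTE ki; rewrite ki sum1_card card_ord.
rewrite prod_nat_const cardC1 card_ord -mulnA -expnSr.
have -> : d.-1.+1 = d by rewrite prednK//; exact: leq_ltn_trans (leq0n _) (ltn_ord i).
by rewrite big_mkord mulnC.
Qed.

Lemma card_carry (i : 'I_d) a W t : (W %| n)%N -> (t <= W)%N ->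
  (#|[pred x : G | (W - t <= (x i + a) %% W)%N]| * W = n ^ d * t)%N.
Proof.
move=> /dvdnP[k nkW] tW; apply/eqP; rewrite -(eqn_pmul2r n_gt0); apply/eqP.
rewrite mulnAC (card_coord_mul i (fun j => W - t <= (j + a) %% W)%N).
by rewrite {2}nkW sum_carry// nkW; lia.
Qed.

Local Close Scope nat_scope.
Variables (R : realType) (i0 : 'I_d) (t : nat).

Definition cyc_shift (x : G) : G :=
  [ffun k => Ordinal (ltn_pmod (x k + (if k == i0 then t else 0%N)) n_gt0)].

Lemma cyc_shift_inj : injective cyc_shift.
Proof.
move=> x y /ffunP xy; apply/ffunP => k; apply/val_inj => /=.
have := xy k; rewrite !ffunE => /(congr1 val) /= /eqP; rewrite eqn_modDr.
by rewrite !modn_small// => /eqP.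
Qed.

(** The shift permutes the grid, so the sum equals that of the averages of [F] and its shift. These
    vanish off [bad] and are at most 1 in absolute value on it. *)
Lemma sum_cyc_shift_le (F : G -> R) (bad : pred G) : (forall x, `|F x| <= 1) ->
  (forall x, ~~ bad x -> F (cyc_shift x) = - F x) ->
  `|\sum_x F x| <= #|[pred x | bad x]|%:R.
Proof.
move=> F1 Fs.
have -> : \sum_x F x = 2^-1 * \sum_x (F x + F (cyc_shift x)).
  have e : \sum_x F (cyc_shift x) = \sum_x F x by rewrite [RHS](reindex_inj cyc_shift_inj).
  by rewrite big_split /= e; lra.
rewrite -sum1_card natr_sum /= normrM ger0_norm ?invr_ge0//.
rewrite mulrC ler_pdivrMr// mulr_suml; apply: (le_trans (ler_norm_sum _ _ _)).
rewrite [leRHS]big_mkcond /=; apply: ler_sum => x _; case: ifPn => bx; last by rewrite Fs// subrr normr0.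
by rewrite mul1r; apply: (le_trans (ler_normD _ _)); have := F1 x; have := F1 (cyc_shift x); lra.
Qed.

End Grid.

Section Oscillation.
Variables (R : realType) (d : nat) (i0 : 'I_d) (N M L : nat).
Hypotheses (NL : (N <= L)%N) (ML : (M <= L)%N) (L2 : (2 <= L)%N).

Definition cube_index := {ffun 'I_d -> 'I_(2 ^ M)}.
(** The wave exponents are [L, 2L, ...], one for each cube. The two further blocks of [L] digits
    keep the positions above [freq q + L] that a shift leaves intact, and above these the [M] and
    [N] leading digits that determine cube and cell. *)
Definition depth := (L * (#|{: cube_index}| + 2))%N.
Notation K := depth.
Notation n := (2 ^ depth)%N.
Notation G := {ffun 'I_d -> 'I_(2 ^ depth)}.
Implicit Types (x : G) (y o : 'I_d -> nat) (q : cube_index).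

Let n_gt0 : (0 < n)%N. Proof. by rewrite expn_gt0. Qed.
Let pM_gt0 : (0 < 2 ^ M)%N. Proof. by rewrite expn_gt0. Qed.

Definition cube y : cube_index := [ffun k => Ordinal (ltn_pmod (y k %/ 2 ^ (K - M))%N pM_gt0)].
Definition freq q := (L * (enum_rank q).+1)%N.
(* Distinct cubes of side 2^-M carry waves whose wavelengths differ by a factor of at
   least 2^L, so that a half-period shift of the finer wave is invisible to the coarser. *)
Definition osc y := odd (y i0 %/ 2 ^ freq (cube y))%N.
Definition wave q y : R := (cube y == q)%:R * (-1) ^+ odd (y i0 %/ 2 ^ freq q)%N.
Definition cell N c x := [forall k, (x k %/ 2 ^ (K - N))%N == c k :> nat].

Let freq_le q : (freq q + L + L <= K)%N.
Proof.
rewrite /freq /depth mulnDr muln2 -addnn addnA !leq_add2r leq_mul2l ltn_ord orbT //.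
Qed.

Let freq_gap q q' : (freq q < freq q')%N -> (freq q + L <= freq q')%N.
Proof.
rewrite /freq ltn_mul2l => /andP[_ qq']; by rewrite -mulnSr leq_mul2l qq' orbT.
Qed.

Let freq_neq q q' : q != q' -> freq q != freq q'.
Proof.
apply: contra => /eqP/eqP; rewrite /freq eqn_mul2l => /orP[/eqP L0|]; first by lia.
by rewrite eqSS => /eqP /val_inj /enum_rank_inj ->.
Qed.

Lemma cube_mod y y' : (forall k, y k = y' k %[mod n]) -> cube y = cube y'.
Proof.
move=> yy; apply/ffunP => k; apply/val_inj; rewrite !ffunE /=.
by apply: (@digits_mod K) => //; rewrite subnK// (leq_trans ML)// /depth leq_pmulr// addn2.
Qed.

Let oddE m : odd m = (m %% 2 ^ 1 == 1)%N.
Proof. by rewrite expn1 modn2; case: (odd m). Qed.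

Lemma odd_mod e a b : (e < K)%N -> a = b %[mod n] -> odd (a %/ 2 ^ e) = odd (b %/ 2 ^ e).
Proof. by move=> eK ab; rewrite !oddE (@digits_mod K _ _ a b)// addn1. Qed.

Lemma osc_mod y y' : (forall k, y k = y' k %[mod n]) -> osc y = osc y'.
Proof.
move=> yy; rewrite /osc (cube_mod yy); apply: odd_mod (yy i0).
by have := freq_le (cube y'); lia.
Qed.

(** The points where adding [2 ^ p] in coordinate [i0] carries into the digits from position [p + L]
    on. They form the fraction [2 ^ -L] of the grid, and elsewhere the shift does not affect those
    digits. *)
Definition carry p o (x : G) := (2 ^ (p + L) - 2 ^ p <= (x i0 + o i0) %% 2 ^ (p + L))%N.

Section Shift.
Variable q0 : cube_index.
Notation p := (freq q0).
Notation sh := (cyc_shift n_gt0 i0 (2 ^ p)).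

Definition off o x : 'I_d -> nat := fun k => (x k + o k)%N.

Let nocarry o x : ~~ carry p o x -> ((x i0 + o i0) %% 2 ^ (p + L) + 2 ^ p < 2 ^ (p + L))%N.
Proof. by rewrite -ltnNge; lia. Qed.

Lemma shift_mod o x k :
  off o (sh x) k = off o x k + (if k == i0 then 2 ^ p else 0)%N %[mod n].
Proof. by rewrite /off ffunE /= modnDml addnAC. Qed.

Let digits_shift o x e m k : ~~ carry p o x -> (p + L <= e)%N -> (e + m <= K)%N ->
  ((off o (sh x) k %/ 2 ^ e) %% 2 ^ m = (off o x k %/ 2 ^ e) %% 2 ^ m)%N.
Proof.
move=> nc pe em; rewrite (@digits_mod K _ _ _ _ em (shift_mod o x k)).
case: eqP => [->|_]; last by rewrite addn0.
by rewrite (divn_nocarry (dvdn_exp2l 2 pe))//; exact: nocarry.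
Qed.

Let p_le : (p + L <= K - L)%N. Proof. by have := freq_le q0; lia. Qed.

Lemma cell_shift c x : ~~ carry p (fun=> 0%N) x -> cell N c (sh x) = cell N c x.
Proof.
move=> nc; apply: eq_forallb => k; congr (_ == _).
have H (z : G) : (z k %/ 2 ^ (K - N) = (off (fun=> 0) z k %/ 2 ^ (K - N)) %% 2 ^ N)%N.
  rewrite /off addn0 modn_small// ltn_divLR ?expn_gt0// -expnD subnKC//.
  by have := freq_le q0; lia.
by rewrite !H; apply: digits_shift => //; have := p_le; lia.
Qed.

Lemma cube_shift o x : ~~ carry p o x -> cube (off o (sh x)) = cube (off o x).
Proof.
move=> nc; apply/ffunP => k; apply/val_inj; rewrite !ffunE /=.
by apply: digits_shift => //; have := p_le; lia.
Qed.

Lemma wave_shift q o x : (p < freq q)%N -> ~~ carry p o x ->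
  wave q (off o (sh x)) = wave q (off o x).
Proof.
move=> pq nc; rewrite /wave cube_shift// !oddE digits_shift//; first exact: freq_gap.
by have := freq_le q; lia.
Qed.

Lemma wave_shiftN o x : ~~ carry p o x -> wave q0 (off o (sh x)) = - wave q0 (off o x).
Proof.
move=> nc; rewrite /wave cube_shift//.
rewrite (@odd_mod p _ _ _ (shift_mod o x i0)); last by have := p_le; lia.
rewrite eqxx divnDr// divnn expn_gt0 /= oddD /= addbT -mulrN.
by congr (_ * _); case: odd; rewrite /= ?expr0 ?expr1 ?opprK.
Qed.

Lemma card_carry_freq o : #|[pred x | carry p o x]|%:R = (n ^ d)%:R / (2 ^ L)%:R :> R.
Proof.
have := @card_carry d n n_gt0 i0 (o i0) (2 ^ (p + L)) (2 ^ p).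
have -> : (2 ^ (p + L) %| n)%N by apply: dvdn_exp2l; have := p_le; lia.
have -> : (2 ^ p <= 2 ^ (p + L))%N by rewrite leq_exp2l// leq_addr.
move=> /(_ isT isT); rewrite expnD mulnA mulnAC => /eqP.
rewrite eqn_pmul2r ?expn_gt0// => /eqP <-.
by rewrite natrM mulfK // /carry expnD.
Qed.

End Shift.

Let norm_bool (b : bool) : `|b%:R : R| <= 1.
Proof. by case: b; rewrite ?normr0 ?normr1. Qed.

Lemma wave_abs_le1 q y : `|wave q y| <= 1.
Proof. by rewrite /wave normrM normrX normrN1 expr1n mulr1 norm_bool. Qed.

Let card_or (P Q : pred G) (a b : R) : #|[pred x | P x]|%:R <= a -> #|[pred x | Q x]|%:R <= b ->
  #|[pred x | P x || Q x]|%:R <= a + b.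
Proof.
move=> Pa Qb; apply: le_trans (lerD Pa Qb).
by rewrite -natrD ler_nat -cardUI leq_addr.
Qed.

(** Shifting by half a period [2 ^ freq q] flips the wave and preserves the cell, apart from two
    carry sets: one for [x] itself and one for [x] displaced by [o]. *)
Lemma sum_wave q c o :
  `|\sum_x (cell N c x)%:R * wave q (off o x)| <= 2 * ((n ^ d)%:R / (2 ^ L)%:R).
Proof.
pose bad x := carry (freq q) (fun=> 0%N) x || carry (freq q) o x.
apply: (@le_trans _ _ #|[pred x | bad x]|%:R).
  apply: (@sum_cyc_shift_le _ _ n_gt0 R i0 (2 ^ freq q)) => x.
    by rewrite normrM mulr_ile1 ?normr_ge0 ?wave_abs_le1 ?norm_bool.
  by rewrite negb_or => /andP[b1 b2]; rewrite cell_shift// wave_shiftN// mulrN.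
by rewrite mulr2n mulrDl mul1r; apply: card_or; rewrite card_carry_freq.
Qed.

(** The shift by half a period of the finer wave flips that wave but neither the coarser one nor the
    cell. Three carry sets are lost: one for the cell and one for each wave. *)
Lemma sum_wave2 q q' c o o' : q != q' ->
  `|\sum_x (cell N c x)%:R * (wave q (off o x) * wave q' (off o' x))|
    <= 3 * ((n ^ d)%:R / (2 ^ L)%:R).
Proof.
move=> qq'; wlog lt : q q' o o' qq' / (freq q < freq q')%N.
  move=> H; have := freq_neq qq'; rewrite neq_ltn => /orP[|] lt; first exact: H.
  under eq_bigr do rewrite [wave q _ * _]mulrC.
  by apply: H => //; rewrite eq_sym.
pose bad x := carry (freq q) (fun=> 0%N) x || (carry (freq q) o x || carry (freq q) o' x).
apply: (@le_trans _ _ #|[pred x | bad x]|%:R).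
  apply: (@sum_cyc_shift_le _ _ n_gt0 R i0 (2 ^ freq q)) => x.
    have ww : `|wave q (off o x) * wave q' (off o' x)| <= 1.
      by rewrite (normrM (wave q _)); apply: mulr_ile1; rewrite ?normr_ge0 ?wave_abs_le1.
    by rewrite (normrM (cell N c x)%:R); apply: mulr_ile1; rewrite ?normr_ge0 ?norm_bool.
  rewrite !negb_or => /and3P[b1 b2 b3]; rewrite cell_shift// wave_shiftN//.
  by rewrite (wave_shift lt b3) mulNr mulrN.
rewrite (_ : 3 * _ = ((n ^ d)%:R / (2 ^ L)%:R) + ((n ^ d)%:R / (2 ^ L)%:R + (n ^ d)%:R / (2 ^ L)%:R)).
  by apply: card_or; [|apply: card_or]; rewrite card_carry_freq.
by lra.
Qed.

End Oscillation.

(** Subtraction with borrow in base [w]: the leading part of a cyclic difference, together with [X]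
    and the borrow bit, determines [T]. *)
Lemma divn_sub_borrow w P x0 t0 X T : (x0 < w)%N -> (t0 < w)%N -> (T < P)%N ->
  ((w * X + x0 + (w * P - (w * T + t0))) %/ w + (x0 < t0) + T = X + P)%N.
Proof.
move=> xw tw TP; have w0 : (0 < w)%N by lia.
have -> : P = (T + (P - T).-1.+1)%N by lia.
set u := (P - T).-1.
have [xt|tx] := ltnP x0 t0.
  have -> : (w * X + x0 + (w * (T + u.+1) - (w * T + t0)) = (X + u) * w + (w + x0 - t0))%N.
    by rewrite mulnDr mulnS mulnDl; lia.
  by rewrite divnMDl// divn_small; lia.
have -> : (w * X + x0 + (w * (T + u.+1) - (w * T + t0)) = (X + u.+1) * w + (x0 - t0))%N.
  by rewrite mulnDr mulnS mulnDl mulSn; lia.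
by rewrite divnMDl// divn_small; lia.
Qed.

(** * Second moment of the deviation from half of the mass *)

Section Energy.
Variables (R : realType) (d : nat) (i0 : 'I_d) (N M L : nat).
Hypotheses (NL : (N <= L)%N) (ML : (M <= L)%N) (L2 : (2 <= L)%N).

Notation K := (depth d M L).
Notation n := (2 ^ depth d M L)%N.
Notation G := {ffun 'I_d -> 'I_(2 ^ depth d M L)}.
Notation cube := (@cube d M L).
Notation osc := (@osc d i0 M L).
Notation wave := (@wave R d i0 M L).
Notation cell := (@cell d M L N).
Notation B := ((n ^ d)%:R / (2 ^ L)%:R : R).
Notation J := (#|{: cube_index d M}|).
Implicit Types (x t : G) (q : cube_index d M).

Definition cyc_diff x t : 'I_d -> nat := off (fun k => n - t k)%N x.

Lemma sign_osc y : (-1) ^+ osc y = \sum_q wave q y.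
Proof.
rewrite (bigD1 (cube y))//= big1 => [|q qy]; first by rewrite addr0 /wave eqxx mul1r.
by rewrite /wave eq_sym (negbTE qy) mul0r.
Qed.

Lemma sum_cell_osc c o :
  `|\sum_x (cell c x)%:R * (-1) ^+ osc (off o x)| <= J%:R * (2 * B).
Proof.
under eq_bigr do rewrite sign_osc mulr_sumr.
rewrite exchange_big /=; apply: le_trans (ler_norm_sum _ _ _) _.
rewrite mulr_natl -sumr_const; apply: ler_sum => q _; exact: sum_wave.
Qed.

Variables (m : G -> R) (s : R).
Hypotheses (m_ge0 : forall t, 0 <= m t) (m_le1 : \sum_t m t <= 1).
Hypothesis m_le : forall T : 'I_d -> nat,
  \sum_(t : G | [forall k, t k %/ 2 ^ (K - M) == T k]%N) m t <= s.

Let MK : (M <= K)%N.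
Proof. by rewrite (leq_trans ML)// /depth leq_pmulr// addn2. Qed.

(** For fixed [x], the [t] whose cyclic difference falls in the cube [q] lie in at most [2 ^ d]
    cubes of the same side, one for each pattern [b] of borrows. *)
Lemma cube_cyc_diff_mass x q : \sum_(t | cube (cyc_diff x t) == q) m t <= (2 ^ d)%:R * s.
Proof.
pose w := (2 ^ (K - M))%N; have w0 : (0 < w)%N by rewrite expn_gt0.
pose e (t : G) : {ffun 'I_d -> bool} := [ffun k => (x k %% w < t k %% w)%N].
rewrite (partition_big e xpredT)//=.
have -> : (2 ^ d)%:R * s = \sum_(b : {ffun 'I_d -> bool}) s.
  by rewrite sumr_const card_ffun card_bool card_ord mulr_natl.
apply: ler_sum => b _.
pose T k := ((x k %/ w + 2 ^ M - b k - q k) %% 2 ^ M)%N.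
apply: le_trans (m_le T); rewrite big_mkcond [leRHS]big_mkcond /=.
apply: ler_sum => t _; case: ifPn => [/andP[/eqP tq /eqP tb]|_]; last by case: ifP.
suff -> : [forall k, t k %/ 2 ^ (K - M) == T k]%N by [].
apply/forallP => k; rewrite -/w; apply/eqP.
have nw : (n = w * 2 ^ M)%N by rewrite /w -expnD subnK.
have tP : (t k %/ w < 2 ^ M)%N by rewrite ltn_divLR// mulnC -nw.
have := @divn_sub_borrow w (2 ^ M) _ _ (x k %/ w) _ (ltn_pmod (x k) w0) (ltn_pmod (t k) w0) tP.
rewrite -nw ![(w * (_ %/ _))%N]mulnC -!divn_eq.
have := congr1 (fun z : cube_index d M => val (z k)) tq; rewrite /cube ffunE /= -/w.
have := congr1 (fun z : {ffun 'I_d -> bool} => z k) tb; rewrite /= ffunE => ->.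
rewrite /cyc_diff /off => qE; rewrite [X in (X + _ + _)%N = _](divn_eq _ (2 ^ M)) qE.
set u := (_ %/ 2 ^ M)%N => E; rewrite /T.
have -> : (x k %/ w + 2 ^ M - b k - q k = u * 2 ^ M + t k %/ w)%N.
  by rewrite -E addnAC addnK addnAC addnK.
by rewrite modnMDl modn_small.
Qed.

Let Z q x := \sum_t m t * wave q (cyc_diff x t).

Lemma sum_osc_split x : \sum_t m t * (-1) ^+ osc (cyc_diff x t) = \sum_q Z q x.
Proof.
under eq_bigr do rewrite sign_osc mulr_sumr.
by rewrite exchange_big.
Qed.

Let Z_le q x : `|Z q x| <= \sum_(t | cube (cyc_diff x t) == q) m t.
Proof.
apply: le_trans (ler_norm_sum _ _ _) _; rewrite [leRHS]big_mkcond /=.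
apply: ler_sum => t _; rewrite normrM ger0_norm//; case: ifPn => [_|/negbTE tq].
  by rewrite ler_piMr// wave_abs_le1.
by rewrite /wave tq mul0r normr0 mulr0.
Qed.

Let s_ge0 : 0 <= s.
Proof. exact: le_trans (sumr_ge0 _ (fun t _ => m_ge0 t)) (m_le (fun=> 0%N)). Qed.

(** One factor of each square is bounded by the largest possible mass of a class, the other by the
    mass of its own class; the classes partition a total mass of at most 1. *)
Let diag x : \sum_q Z q x ^+ 2 <= (2 ^ d)%:R * s.
Proof.
apply: (@le_trans _ _ (\sum_q ((2 ^ d)%:R * s) * \sum_(t | cube (cyc_diff x t) == q) m t)).
  apply: ler_sum => q _; rewrite -real_normK ?num_real// expr2.
  by apply: ler_pM => //; rewrite (le_trans (Z_le q x)) ?cube_cyc_diff_mass.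
rewrite -mulr_sumr ler_piMr ?mulr_ge0//; apply: le_trans m_le1.
by rewrite (partition_big (fun t => cube (cyc_diff x t)) xpredT).
Qed.

Let B_ge0 : 0 <= B. Proof. by rewrite divr_ge0. Qed.

Let offdiag c q q' : q != q' -> `|\sum_x (cell c x)%:R * (Z q x * Z q' x)| <= 3 * B.
Proof.
move=> qq'.
have -> : \sum_x (cell c x)%:R * (Z q x * Z q' x) =
    \sum_t \sum_t' (m t * m t') * \sum_x (cell c x)%:R * (wave q (cyc_diff x t) * wave q' (cyc_diff x t')).
  under eq_bigr do rewrite /Z big_distrlr /= mulr_sumr.
  rewrite exchange_big /=; apply: eq_bigr => t _.
  under eq_bigr do rewrite mulr_sumr.
  rewrite exchange_big /=; apply: eq_bigr => t' _.
  by rewrite mulr_sumr; apply: eq_bigr => x _; ring.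
apply: (@le_trans _ _ (\sum_t \sum_t' (m t * m t') * (3 * B))).
  apply: le_trans (ler_norm_sum _ _ _) _; apply: ler_sum => t _.
  apply: le_trans (ler_norm_sum _ _ _) _; apply: ler_sum => t' _.
  rewrite normrM ger0_norm ?mulr_ge0//; apply: ler_wpM2l; first exact: mulr_ge0.
  exact: sum_wave2.
under eq_bigr do rewrite -mulr_suml -mulr_sumr.
have m0 : 0 <= \sum_t m t by exact: sumr_ge0.
rewrite -mulr_suml -mulr_suml ler_piMl ?mulr_ge0//; exact: mulr_ile1.
Qed.

(* Second moment over the cell: pairs in a common cube contribute the first term, by the
   Frostman-type bound [m_le], and pairs in distinct cubes are almost uncorrelated. *)
Lemma energy_le c :
  \sum_x (cell c x)%:R * (\sum_t m t * (-1) ^+ osc (cyc_diff x t)) ^+ 2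
    <= #|[pred x | cell c x]|%:R * ((2 ^ d)%:R * s) + J%:R * J%:R * (3 * B).
Proof.
have -> : \sum_x (cell c x)%:R * (\sum_t m t * (-1) ^+ osc (cyc_diff x t)) ^+ 2 =
    \sum_x (cell c x)%:R * (\sum_q Z q x ^+ 2) +
    \sum_q \sum_(q' | q' != q) \sum_x (cell c x)%:R * (Z q x * Z q' x).
  under [X in _ = _ + X]eq_bigr do rewrite exchange_big /=.
  rewrite [X in _ = _ + X]exchange_big -big_split /=; apply: eq_bigr => x _.
  rewrite sum_osc_split expr2 big_distrlr /= !mulr_sumr -big_split /=.
  apply: eq_bigr => q _; rewrite (bigD1 q)//= mulrDr expr2; congr (_ + _).
  by rewrite mulr_sumr.
apply: lerD.
  rewrite -sum1_card natr_sum mulr_suml [leRHS]big_mkcond /=; apply: ler_sum => x _.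
  by rewrite inE; case: (cell c x); rewrite ?mul0r// !mul1r.
rewrite -mulrA mulr_natl -sumr_const; apply: ler_sum => q _.
rewrite mulr_natl -sumr_const big_mkcond /=; apply: ler_sum => q' _.
case: ifPn => [qq'|_]; last by rewrite mulr_ge0.
by apply: le_trans (ler_norm _) _; apply: offdiag; rewrite eq_sym.
Qed.

End Energy.

Definition in_cell d K N (c : 'I_d -> nat) (x : {ffun 'I_d -> 'I_(2 ^ K)}) :=
  [forall k, x k %/ 2 ^ (K - N) == c k]%N.

Lemma card_in_cell d K N c : (#|[pred x | @in_cell d K N c x]| <= 2 ^ ((K - N) * d))%N.
Proof.
pose w := (2 ^ (K - N))%N; have w0 : (0 < w)%N by rewrite expn_gt0.
pose g (x : {ffun 'I_d -> 'I_(2 ^ K)}) : {ffun 'I_d -> 'I_w} :=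
  [ffun k => Ordinal (ltn_pmod (x k) w0)].
have g_inj : {in [pred x | in_cell N c x] &, injective g}.
  move=> x y; rewrite !inE => /forallP xc /forallP yc /ffunP xy.
  apply/ffunP => k; apply/val_inj.
  have := congr1 val (xy k); rewrite !ffunE /= => mxy.
  by rewrite (divn_eq (x k) w) (divn_eq (y k) w) mxy (eqP (xc k)) (eqP (yc k)).
rewrite (leq_trans (@leq_card_in _ _ _ _ g_inj))//.
by rewrite card_ffun !card_ord -expnM.
Qed.

Lemma exp2_ge (R : realType) (a : R) : exists L0, forall L, (L0 <= L)%N -> a <= (2 ^ L)%:R.
Proof.
have [L0 L0a] : exists L0 : nat, a <= L0%:R.
  by exists (Num.truncn a).+1; exact: ltW (truncnS_gt _).
exists L0 => L LL; apply: (le_trans L0a); rewrite ler_nat.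
by rewrite (leq_trans LL)// ltnW// ltn_expl.
Qed.

Lemma card_cover (T I : finType) (A good : pred T) (bad : I -> pred T) :
  (forall x, A x -> good x || [exists k, bad k x]) ->
  (#|A| <= #|good| + \sum_k #|bad k|)%N.
Proof.
move=> Ab; have E (P : pred T) : #|P| = (\sum_x P x)%N.
  by rewrite -sum1_card big_mkcond; apply: eq_bigr => x _; rewrite unfold_in; case: (P x).
rewrite !E (eq_bigr _ (fun k _ => E (bad k))) exchange_big -big_split /=.
apply: leq_sum => x _; case: (boolP (A x)) => // /Ab /orP[->|/existsP[k bk]] //.
by rewrite (bigD1 k)//= bk addnCA.
Qed.

Lemma sign_half (R : realType) (b : bool) : (~~ b)%:R = 2^-1 * (1 + (-1) ^+ b) :> R.
Proof. by case: b; rewrite /= ?expr1 ?expr0; lra. Qed.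

Lemma sqr_deviation (R : realType) (e S T : R) : 0 < e ->
  2^-1 * (S + T) < 2^-1 * S - e -> 4 * e ^+ 2 <= T ^+ 2.
Proof. by nra. Qed.

(* For a finite set of grid points [t] weighted by [m], most grid points [x] of each cell
   of depth [N] keep about half of the mass when only the [t] with [f (x - t)] are
   retained. The shifts [v] account for the loss of a unit when differences of reals are
   replaced by differences of grid points. *)
Lemma oscillating_selector (R : realType) d (i0 : 'I_d) (psi : nat -> R) N (e : R) :
  (forall h, 0 < h -> exists M, psi M <= h) -> 0 < e ->
  exists K (f : ('I_d -> nat) -> bool), [/\ (N <= K)%N,
    forall y y', (forall k, y k = y' k %[mod 2 ^ K]) -> f y = f y',
    forall c, (4 * #|[pred x : {ffun 'I_d -> 'I_(2 ^ K)} | in_cell N c x &&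
      [exists v : {ffun 'I_d -> 'I_4}, f (fun k => x k + (2 ^ K - 1) + v k)]]|
      <= 3 * 2 ^ ((K - N) * d))%N &
    forall m : {ffun 'I_d -> 'I_(2 ^ K)} -> R, (forall t, 0 <= m t) -> \sum_t m t <= 1 ->
      (forall M T, (M <= K)%N -> \sum_(t | in_cell M T t) m t <= psi M) ->
      forall c, #|[pred x : {ffun 'I_d -> 'I_(2 ^ K)} | in_cell N c x &&
        (\sum_(t : {ffun 'I_d -> 'I_(2 ^ K)} | f (fun k => x k + (2 ^ K - t k))%N) m t < 2^-1 * (\sum_t m t) - e)]|%:R
          <= e * (2 ^ ((K - N) * d))%:R].
Proof.
move=> psi0 e0.
(* Chebyshev's inequality: a loss of more than [e] forces a squared deviation of at least
   [4 * e ^+ 2]. A bad proportion of at most [e] thus requires a mean square of at most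
   [4 * e ^+ 3]. Half of this is allotted to near pairs through [M], half to far pairs through
   [L]. *)
have [M psiM] : exists M, psi M <= 2 * e ^+ 3 / (2 ^ d)%:R.
  by apply: psi0; rewrite divr_gt0 ?mulr_gt0 ?exprn_gt0// ltr0n expn_gt0.
have [J JE] : exists J : R, J = #|{: cube_index d M}|%:R by eexists.
have [P PE] : exists P : R, P = (2 ^ (N * d))%:R by eexists.
(* The first bound on [2 ^ L] makes the far pairs contribute at most [2 * e ^+ 3] times the cell
   size. The second leaves room for volume: half a cell, plus the errors [J * B] of the waves and
   [3 * d * B] of the carries, is at most three quarters. *)
have [L [NL ML L_2 HL1 HL2]] : exists L, [/\ (N <= L)%N, (M <= L)%N, (2 <= L)%N,
    3 * J * J * P / (2 * e ^+ 3) <= (2 ^ L)%:R & 4 * (J + 3 * d%:R) * P <= (2 ^ L)%:R].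
  have [L1 HL1] := exp2_ge (3 * J * J * P / (2 * e ^+ 3)).
  have [L2 HL2] := exp2_ge (4 * (J + 3 * d%:R) * P).
  exists (maxn (maxn N M) (maxn 2 (maxn L1 L2))).
  by split; [lia|lia|lia|apply: HL1; lia|apply: HL2; lia].
pose K := depth d M L.
have NK : (N <= K)%N by rewrite (leq_trans NL)// /K /depth leq_pmulr// addn2.
have MK : (M <= K)%N by rewrite (leq_trans ML)// /K /depth leq_pmulr// addn2.
have LK : (L <= K)%N by rewrite /K /depth leq_pmulr// addn2.
have LKM : (L <= K - M)%N.
  rewrite leq_subRL// addnC (leq_trans (leq_add (leqnn L) ML))//.
  by rewrite /K /depth mulnDr muln2 -addnn leq_addl.
have n0 : (0 < 2 ^ K)%N by rewrite expn_gt0.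
pose f (y : 'I_d -> nat) := ~~ @osc d i0 M L y.
have fmod y y' : (forall k, y k = y' k %[mod 2 ^ K]) -> f y = f y'.
  by move=> yy; rewrite /f (osc_mod i0 NL ML L_2 yy).
have [pL pLE] : exists pL : R, pL = (2 ^ L)%:R by eexists.
have pL0 : 0 < pL by rewrite pLE ltr0n expn_gt0.
have [V VE] : exists V : R, V = (2 ^ ((K - N) * d))%:R by eexists.
have V0 : 0 < V by rewrite VE ltr0n expn_gt0.
have VP : ((2 ^ K) ^ d)%:R = V * P.
  by rewrite VE PE -natrM -expnD -mulnDl subnK// expnM.
have [B BE] : exists B : R, B = ((2 ^ K) ^ d)%:R / (2 ^ L)%:R by eexists.
have BVP : B = V * P / pL by rewrite BE VP pLE.
have B0 : 0 <= B by rewrite BE divr_ge0.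
rewrite -pLE in HL1 HL2.
have BJ3 : J * J * (3 * B) <= V * (2 * e ^+ 3).
  have -> : J * J * (3 * B) = V * (3 * J * J * P) / pL.
    by rewrite BVP !mulrA; congr (_ / _); ring.
  have e3 : 0 < 2 * e ^+ 3 by rewrite mulr_gt0// exprn_gt0.
  by rewrite -mulrA ler_pM2l// ler_pdivrMr// [leRHS]mulrC -ler_pdivrMr.
have BJ : 4 * (J + 3 * d%:R) * B <= V.
  have -> : 4 * (J + 3 * d%:R) * B = V * (4 * (J + 3 * d%:R) * P) / pL.
    by rewrite BVP mulrA; congr (_ / _); ring.
  by rewrite ler_pdivrMr// ler_pM2l.
have cellV c : #|[pred x | @in_cell d K N c x]|%:R <= V by rewrite VE ler_nat card_in_cell.
exists K, f; split => //.
- move=> c.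
  (* Off these sets adding up to 3 changes no digit from position [L] on, and [osc] reads only
     those. Hence every [v] may be replaced by 1, which cancels the -1 modulo [2 ^ K]. *)
  pose bad (k : 'I_d) := [pred x : {ffun 'I_d -> 'I_(2 ^ K)} | (2 ^ L - 3 <= (x k + (2 ^ K - 1)) %% 2 ^ L)%N].
  pose good := [pred x : {ffun 'I_d -> 'I_(2 ^ K)} | in_cell N c x && f (off (fun=> 0%N) x)].
  have sub (x : {ffun 'I_d -> 'I_(2 ^ K)}) : in_cell N c x &&
      [exists v : {ffun 'I_d -> 'I_4}, f (fun k => x k + (2 ^ K - 1) + v k)%N] ->
      good x || [exists k, bad k x].
    move=> /andP[xc /existsP[v fv]]; rewrite /good /= xc /=.
    have [//|nb] := boolP [exists k, bad k x]; first by rewrite orbT.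
    rewrite orbF; move: nb; rewrite negb_exists => /forallP nb.
    have H (k : 'I_d) e' w : (L <= e')%N -> (w <= 3)%N ->
        ((x k + (2 ^ K - 1) + w) %/ 2 ^ e' = (x k + (2 ^ K - 1)) %/ 2 ^ e')%N.
      move=> Le w3; apply: divn_nocarry; first exact: dvdn_exp2l Le.
      have := nb k; rewrite /bad /= -ltnNge ltn_subRL addnC.
      by apply: leq_ltn_trans; rewrite leq_add2l.
    have H1 w : (forall k, w k <= 3)%N -> f (fun k => x k + (2 ^ K - 1) + w k)%N = f (fun k => x k + (2 ^ K - 1))%N.
      move=> w3; rewrite /f /osc.
      have -> : cube M L (fun k => x k + (2 ^ K - 1) + w k)%N = cube M L (fun k => x k + (2 ^ K - 1))%N.
        apply/ffunP => k; apply/val_inj; rewrite !ffunE /= H//.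
      by rewrite H// /freq mulnS leq_addr.
    move: fv; rewrite H1; last by move=> k; rewrite -ltnS.
    rewrite -(H1 (fun=> 1%N))// => fv.
    rewrite (fmod _ (fun k => x k + (2 ^ K - 1) + 1)%N)// => k.
    by rewrite -addnA subnK// modnDr /off addn0.
  have card_good : #|good|%:R <= 2^-1 * V + J * B :> R.
    have goodE : #|good|%:R = 2^-1 * (#|[pred x | @in_cell d K N c x]|%:R +
        \sum_(x : {ffun 'I_d -> 'I_(2 ^ K)}) (in_cell N c x)%:R * (-1) ^+ osc i0 M L (off (fun=> 0%N) x)) :> R.
      rewrite -!sum1_card !natr_sum big_mkcond [X in X + _]big_mkcond -big_split mulr_sumr /=.
      apply: eq_bigr => x _; rewrite !inE /f /=.
      case: (in_cell N c x); rewrite /= ?mul0r ?addr0 ?mulr0// mul1r -sign_half.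
      by case: (osc _ _ _ _).
    rewrite goodE; have := sum_cell_osc R i0 NL ML L_2 c (fun=> 0%N).
    rewrite -BE -JE => /ler_normlP[_ so]; have := cellV c.
    move: so; rewrite /in_cell /cell; set S := \sum_(_ | _) _; set C := #|_|%:R => so Cle.
    clearbody S C; clear -so Cle; lra.
  have card_bad k : #|bad k|%:R = 3 * B :> R.
    have := @card_carry d (2 ^ K) n0 k (2 ^ K - 1) (2 ^ L) 3 (dvdn_exp2l 2 LK).
    have -> : (3 <= 2 ^ L)%N by rewrite (@leq_trans (2 ^ 2))// leq_exp2l.
    move=> /(_ isT) /(congr1 (fun z : nat => z%:R : R)); rewrite !natrM => cb.
    by rewrite BE mulrA; apply: (canRL (mulfK _)); [rewrite -pLE gt_eqF|rewrite cb mulrC].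
  rewrite -(ler_nat R) 2!natrM -VE.
  apply: (@le_trans _ _ (4 * (#|good|%:R + \sum_k #|bad k|%:R))).
    by rewrite ler_pM2l// -natr_sum -natrD ler_nat; apply: card_cover => x; exact: sub.
  rewrite (eq_bigr (fun=> 3 * B)) => [|k _]; last exact: card_bad.
  rewrite sumr_const card_ord -(mulr_natr (3 * B)).
  move: (#|good|%:R) card_good (d%:R : R) BJ => g gle D BJ; clear -gle BJ; nra.
- move=> m m0 m1 mpsi c.
  have := energy_le i0 NL ML L_2 m0 m1 (fun T => mpsi M T MK) c.
  rewrite -BE -JE; set E := (X in X <= _) => Ele.
  have {}Ele : E <= V * (4 * e ^+ 3).
    apply: (le_trans Ele).
    have -> : V * (4 * e ^+ 3) = V * (2 * e ^+ 3) + V * (2 * e ^+ 3) by ring.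
    apply: lerD => //.
    have p2 : (2 ^ d)%:R * psi M <= 2 * e ^+ 3.
      by rewrite mulrC -ler_pdivlMr// ltr0n expn_gt0.
    apply: (@le_trans _ _ (#|[pred x | @in_cell d K N c x]|%:R * (2 * e ^+ 3))).
      exact: ler_wpM2l.
    by apply: ler_wpM2r => //; rewrite mulr_ge0// ltW// exprn_gt0.
  have e20 : 0 < 4 * e ^+ 2 by rewrite mulr_gt0// exprn_gt0.
  rewrite -(ler_pM2r e20) (_ : e * _ * _ = V * (4 * e ^+ 3)); last by rewrite -VE; ring.
  apply: le_trans Ele; rewrite -sum1_card natr_sum mulr_suml big_mkcond /=.
  apply: ler_sum => x _; rewrite inE; case: ifPn => [/andP[xc lt]|_]; last first.
    by rewrite mulr_ge0// sqr_ge0.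
  rewrite mul1r /= (_ : cell N c x = true)// mul1r.
  set T := (X in _ <= X ^+ 2).
  have fE : \sum_(t : {ffun 'I_d -> 'I_(2 ^ K)} | f (fun k => x k + (2 ^ K - t k))%N) m t = 2^-1 * (\sum_t m t + T).
    rewrite /T -big_split mulr_sumr big_mkcond /=; apply: eq_bigr => t _.
    rewrite /f -/(cyc_diff x t) -{2}[m t]mulr1 -mulrDr mulrCA -sign_half.
    by case: (osc _ _ _ _); rewrite ?mulr1 ?mulr0.
  by move: lt; rewrite fE; apply: sqr_deviation.
Qed.

(** * Dyadic codes and iteration *)

Section Codes.
Variable d : nat.
Notation D := {ffun 'I_d -> bool}.
Implicit Types (s t : seq D) (i : 'I_d).

Definition dcoord s i : nat := foldl (fun a (g : D) => a.*2 + g i)%N 0%N s.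

Lemma dcoord_rcons s g i : dcoord (rcons s g) i = ((dcoord s i).*2 + g i)%N.
Proof. by rewrite /dcoord foldl_rcons. Qed.

Lemma dcoord_lt s i : (dcoord s i < 2 ^ size s)%N.
Proof.
elim/last_ind: s => // s g IH; rewrite dcoord_rcons size_rcons expnS mul2n.
by rewrite -addn1 -addnA (leq_trans (n := (dcoord s i).*2 + 2))// ?leq_add2l; [case: (g i)|lia].
Qed.

Lemma dcoord_take s i n : (n <= size s)%N -> dcoord (take n s) i = (dcoord s i %/ 2 ^ (size s - n))%N.
Proof.
elim/last_ind: s => [|s g IH]; first by rewrite leqn0 => /eqP ->.
rewrite size_rcons leq_eqVlt => /orP[/eqP ->|].
  by rewrite subnn divn1 -(size_rcons s g) take_size.
rewrite ltnS => ns; rewrite -cats1 takel_cat// IH// cats1 dcoord_rcons subSn// expnS divnMA.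
by congr (_ %/ _)%N; rewrite -muln2 divnMDl// divn_small ?addn0//; case: (g i).
Qed.

Lemma dcoord_inj s t : size s = size t -> dcoord s =1 dcoord t -> s = t.
Proof.
elim/last_ind: s t => [|s g IH] t; first by case: t.
case/lastP: t => [|t h]; rewrite !size_rcons // => -[st] e.
have gh i : g i = h i /\ dcoord s i = dcoord t i.
  by have := e i; rewrite !dcoord_rcons; case: (g i); case: (h i) => /=; lia.
by congr rcons; [apply: IH => // i; have [] := gh i|apply/ffunP => i; have [] := gh i].
Qed.

Definition code N (x : 'I_d -> nat) : seq D :=
  mkseq (fun k => [ffun i => odd (x i %/ 2 ^ (N - k.+1))%N]) N.

Lemma size_code N x : size (code N x) = N. Proof. exact: size_mkseq. Qed.

Lemma dcoord_code N x i : (x i < 2 ^ N)%N -> dcoord (code N x) i = x i.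
Proof.
move=> xN; suff H k : (k <= N)%N -> dcoord (mkseq (fun k => [ffun i => odd (x i %/ 2 ^ (N - k.+1))%N]) k) i
    = (x i %/ 2 ^ (N - k))%N by rewrite /code H// subnn divn1.
elim: k => [|k IH] kN; first by rewrite subn0 divn_small.
rewrite mkseqS dcoord_rcons IH 1?ltnW// ffunE.
have -> : (N - k = (N - k.+1).+1)%N by lia.
by rewrite expnSr divnMA divn2 addnC odd_double_half.
Qed.

Notation G N := {ffun 'I_d -> 'I_(2 ^ N)}.

Lemma take_code_eq K N (x : G K) s : (N <= K)%N -> size s = N ->
  (take N (code K (fun k => x k)) == s) = in_cell N (dcoord s) x.
Proof.
move=> NK sN; have E i : dcoord (take N (code K (fun k => x k))) i = (x i %/ 2 ^ (K - N))%N.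
  by rewrite dcoord_take ?size_code// dcoord_code.
apply/eqP/forallP => [<- k|xs]; first by rewrite E.
apply: dcoord_inj; first by rewrite size_takel ?size_code.
by move=> k; rewrite E; exact/eqP.
Qed.

Lemma perm_lvl_code N : perm_eq (lvl D N) [seq code N (fun k => x k) | x : G N <- enum {: G N}].
Proof.
have n0 : (0 < 2 ^ N)%N by rewrite expn_gt0.
apply: uniq_perm; first exact: lvl_uniq.
  rewrite map_inj_uniq ?enum_uniq// => x y /(congr1 dcoord) xy.
  apply/ffunP => k; apply/val_inj; have := congr1 (fun z => z k) xy.
  by rewrite !dcoord_code.
move=> s; rewrite mem_lvl; apply/eqP/mapP => [sN|[x _ ->]]; last exact: size_code.
exists [ffun k => Ordinal (ltn_pmod (dcoord s k) n0)]; first by rewrite mem_enum.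
apply: dcoord_inj; rewrite ?size_code// => i; rewrite dcoord_code// ffunE /=.
by rewrite modn_small// -sN dcoord_lt.
Qed.

Lemma big_lvl_code (V : nmodType) N (P : pred (seq D)) (F : seq D -> V) :
  \sum_(s <- lvl D N | P s) F s =
  \sum_(x : G N | P (code N (fun k => x k))) F (code N (fun k => x k)).
Proof. by rewrite (perm_big _ (perm_lvl_code N)) big_map big_enum_cond. Qed.

Lemma size_lvl N : size (lvl D N) = (2 ^ (N * d))%N.
Proof.
by rewrite (perm_size (perm_lvl_code N)) size_map -cardE card_ffun !card_ord expnM.
Qed.

Lemma count_lvl_code N (P : pred (seq D)) :
  count P (lvl D N) = #|[pred x : G N | P (code N (fun k => x k))]|.
Proof. by rewrite -sum1_count big_lvl_code sum1_card. Qed.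

Definition gap (r s : seq D) : 'I_d -> nat := fun k => (dcoord r k + (2 ^ size s - dcoord s k))%N.

Lemma oscillating_selector_seq (R : realType) (i0 : 'I_d) (psi : nat -> R) N (e : R) :
  (forall n, 0 <= psi n) -> (forall h, 0 < h -> exists M, psi M <= h) -> 0 < e ->
  exists K (f : ('I_d -> nat) -> bool), [/\ (N <= K)%N,
    forall y y', (forall k, y k = y' k %[mod 2 ^ K]) -> f y = f y',
    forall c, size c = N -> (4 * count (fun s => (take N s == c) &&
      [exists v : {ffun 'I_d -> 'I_4}, f (fun k => dcoord s k + (2 ^ K - 1) + v k)]) (lvl D K)
      <= 3 * 2 ^ ((K - N) * d))%N &
    forall m : seq D -> R, (forall t, 0 <= m t) -> \sum_(t <- lvl D K) m t <= 1 ->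
      (forall u, (size u <= K)%N ->
        \sum_(t <- lvl D K | take (size u) t == u) m t <= psi (size u)) ->
      forall c, size c = N -> (count (fun r => (take N r == c) &&
        (\sum_(t <- lvl D K | f (gap r t)) m t < 2^-1 * (\sum_(t <- lvl D K) m t) - e))
         (lvl D K))%:R <= e * (2 ^ ((K - N) * d))%:R].
Proof.
move=> psi_ge0 psi0 e0.
have [K [f [NK fmod fat mass]]] := oscillating_selector i0 N psi0 e0.
have cc (x : G K) i : dcoord (code K (fun k => x k)) i = x i by rewrite dcoord_code.
exists K, f; split => //.
- move=> c cN; have := fat (dcoord c); congr (_ * _ <= _)%N; rewrite count_lvl_code.
  apply: eq_card => x; rewrite !inE take_code_eq//; congr (_ && _).
  apply: eq_existsb => v; congr f; apply/funext => k; by rewrite cc.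
- move=> m m0 m1 mpsi c cN.
  have mass' := mass (fun x => m (code K (fun k => x k))) (fun x => m0 _).
  rewrite count_lvl_code big_lvl_code in m1 *.
  apply: le_trans (mass' m1 _ (dcoord c)).
    rewrite ler_nat; apply: eq_leq; apply: eq_card => x.
    rewrite !inE take_code_eq// !big_lvl_code; congr (_ && (_ < _)).
    apply: eq_bigl => t; congr f; apply/funext => k.
    by rewrite /gap !cc size_code.
  move=> M T MK; have [/forallP TM|/forallPn[k Tk]] := boolP [forall k, (T k < 2 ^ M)%N]; last first.
    rewrite big_pred0// => x; apply/negbTE/forallPn; exists k; apply: contra Tk => /eqP <-.
    by rewrite ltn_divLR ?expn_gt0// -expnD subnKC.
  have := mpsi (code M T); rewrite size_code => /(_ MK); apply: le_trans.
  rewrite big_lvl_code le_eqVlt; apply/orP; left; apply/eqP; apply: eq_bigl => x.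
  rewrite take_code_eq ?size_code//; apply: eq_forallb => k.
  by rewrite dcoord_code.
Qed.

End Codes.

(** * Iterating the selection over infinitely many scales *)

Section Selectors.
Variables (R : realType) (d : nat) (i0 : 'I_d) (psi : nat -> R).
Notation D := {ffun 'I_d -> bool}.
Hypothesis psi_ge0 : forall n, 0 <= psi n.
Hypothesis psi_lim : forall h, 0 < h -> exists M, psi M <= h.

(** The quantifier over [m] comes after [f], so that one selection serves every mass distribution
    below [psi]. *)
Definition selects N (e : R) K (f : ('I_d -> nat) -> bool) := [/\ (N <= K)%N,
    forall y y', (forall k, y k = y' k %[mod 2 ^ K]) -> f y = f y',
    forall c : seq D, size c = N -> (4 * count (fun s => (take N s == c) &&
      [exists v : {ffun 'I_d -> 'I_4}, f (fun k => dcoord s k + (2 ^ K - 1) + v k)]) (lvl D K)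
      <= 3 * 2 ^ ((K - N) * d))%N &
    forall m : seq D -> R, (forall t, 0 <= m t) -> \sum_(t <- lvl D K) m t <= 1 ->
      (forall u, (size u <= K)%N ->
        \sum_(t <- lvl D K | take (size u) t == u) m t <= psi (size u)) ->
      forall c : seq D, size c = N -> (count (fun r => (take N r == c) &&
        (\sum_(t <- lvl D K | f (gap r t)) m t < 2^-1 * (\sum_(t <- lvl D K) m t) - e))
         (lvl D K))%:R <= e * (2 ^ ((K - N) * d))%:R].

Lemma selector_sequence (e : nat -> R) : (forall k, 0 < e k) ->
  exists Ns fs, Ns 0%N = 0%N /\ forall k, selects (Ns k) (e k) (Ns k.+1) (fs k).
Proof.
move=> e0.
have [g gP] : {g : nat * nat -> nat * (('I_d -> nat) -> bool) &
    forall Nk, selects Nk.1 (e Nk.2) (g Nk).1 (g Nk).2}.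
  apply: (@choice _ _ (fun Nk Kf => selects Nk.1 (e Nk.2) Kf.1 Kf.2)) => -[N k].
  have [K [f Kf]] := oscillating_selector_seq i0 N psi_ge0 psi_lim (e0 k).
  by exists (K, f).
pose Ns := fix Ns k := if k is k'.+1 then (g (Ns k', k')).1 else 0%N.
by exists Ns, (fun k => (g (Ns k, k)).2); split=> // k; exact: (gP (Ns k, k)).
Qed.

Section Covering.
Variables (c0 : R) (Ns : nat -> nat) (fs : nat -> ('I_d -> nat) -> bool).
Hypotheses (c0_gt0 : 0 < c0) (c0_le1 : c0 <= 1) (Ns0 : Ns 0%N = 0%N).
Let e k := c0 / 4 ^+ k.+1.
Hypothesis fsP : forall k, selects (Ns k) (e k) (Ns k.+1) (fs k).
Variable E : set (nat -> D).
Hypotheses (E_closed : prefix_closed E) (E_content : c0 <= net_content psi E).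

Let c0_ge0 : 0 <= c0 := ltW c0_gt0.
Let m := mass psi E c0.
Let m_ge0 s : 0 <= m s. Proof. exact: mass_ge0. Qed.

Let mass_level (P : pred (seq D)) N K : (N <= K)%N ->
  \sum_(t <- lvl D K | P (take N t)) m t = \sum_(s <- lvl D N | P s) m s.
Proof.
elim: K => [|K IH]; first by rewrite leqn0 => /eqP ->; rewrite !big_cons !big_nil take0.
rewrite leq_eqVlt => /orP[/eqP ->|].
  rewrite big_seq_cond [RHS]big_seq_cond; apply: eq_bigl => t.
  by rewrite mem_lvl; case: eqP => //= <-; rewrite take_size.
rewrite ltnS => NK; rewrite -IH// big_lvlS [RHS]big_mkcond.
apply: eq_big_seq => s; rewrite mem_lvl => /eqP sK.
under eq_bigl do rewrite -cats1 takel_cat ?sK//.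
by case: ifP => Ps; [rewrite -mass_children//|rewrite big_pred0].
Qed.

Let Ns_homo k l : (k <= l)%N -> (Ns k <= Ns l)%N.
Proof. by move: k l; apply: (homo_leq leqnn leq_trans) => k; have [] := fsP k. Qed.

Let alive k r s := all (fun l => fs l (gap (take (Ns l.+1) r) (take (Ns l.+1) s))) (iota 0 k).

Let aliveS k r s : alive k.+1 r s =
  alive k r s && fs k (gap (take (Ns k.+1) r) (take (Ns k.+1) s)).
Proof.
have iE : iota 0 k.+1 = iota 0 k ++ [:: k] by rewrite -addn1 iotaD.
by rewrite /alive iE all_cat /= andbT.
Qed.

Let alive_take k r s : alive k (take (Ns k) r) (take (Ns k) s) = alive k r s.
Proof.
apply: eq_in_all => l; rewrite mem_iota add0n => /andP[_ lk].
by rewrite !take_takel ?Ns_homo.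
Qed.

Let bad k r := \sum_(t <- lvl D (Ns k.+1) | alive k r t && fs k (gap r t)) m t <
  2^-1 * (\sum_(t <- lvl D (Ns k.+1) | alive k r t) m t) - e k.

(** Within one cell [c] of the previous level the set of surviving points is constant, because
    earlier tests read only prefixes. The selector is applied cell by cell to the mass restricted to
    these survivors, which still obeys the gauge bound. *)
Let count_bad k : (count (bad k) (lvl D (Ns k.+1)))%:R <= e k * (2 ^ (Ns k.+1 * d))%:R.
Proof.
have [NK _ _ fmass] := fsP k; set N := Ns k in NK fmass *; set K := Ns k.+1 in NK fmass *.
have -> : count (bad k) (lvl D K) =
    (\sum_(c <- lvl D N) count (fun r => (take N r == c) && bad k r) (lvl D K))%N.
  transitivity (\sum_(r <- lvl D K) \sum_(c <- lvl D N) ((take N r == c) && bad k r))%N; last first.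
    rewrite exchange_big /=; apply: eq_bigr => c _; rewrite -sum1_count [RHS]big_mkcond.
    by apply: eq_bigr => r _; case: (_ && _).
  rewrite -sum1_count [LHS]big_mkcond /=; apply: eq_big_seq => r; rewrite mem_lvl => /eqP rK.
  case: (bad k r); last by rewrite big1// => c _; rewrite andbF.
  under eq_bigr do rewrite andbT eq_sym.
  rewrite -big_mkcond sum1_count count_uniq_mem ?lvl_uniq// mem_lvl size_takel ?rK ?eqxx//.
rewrite natr_sum; apply: (@le_trans _ _ (\sum_(c <- lvl D N) e k * (2 ^ ((K - N) * d))%:R)).
  rewrite big_seq [leRHS]big_seq; apply: ler_sum => c; rewrite mem_lvl => /eqP cN.
  pose m' t := if alive k c t then m t else 0.
  have m'm t : m' t <= m t by rewrite /m'; case: ifP.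
  have m'0 t : 0 <= m' t by rewrite /m'; case: ifP.
  have m1 : \sum_(t <- lvl D K) m t = c0.
    by rewrite (mass_level xpredT (leq0n K)) big_cons big_nil addr0.
  apply: le_trans (fmass m' m'0 _ _ c cN).
  - rewrite ler_nat; apply: sub_count => r /andP[/eqP rc]; rewrite /= rc eqxx /= /bad.
    have ar t : alive k c t = alive k r t.
      by rewrite -(alive_take k r) -(alive_take k c) -rc take_takel.
    rewrite (_ : \sum_(t <- _ | fs k (gap r t)) m' t =
        \sum_(t <- lvl D K | alive k r t && fs k (gap r t)) m t); last first.
      by rewrite big_mkcondl; apply: eq_bigr => t _; rewrite /m' ar.
    rewrite (_ : \sum_(t <- lvl D K) m' t = \sum_(t <- lvl D K | alive k r t) m t)//.
    by rewrite [RHS]big_mkcond; apply: eq_bigr => t _; rewrite /m' ar.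
  - by rewrite (le_trans (ler_sum _ (fun t _ => m'm t))) ?m1.
  - move=> u uK; apply: (le_trans (ler_sum _ (fun t _ => m'm t))).
    rewrite (mass_level (pred1 u) uK) big_mkcond (bigD1_seq u) ?lvl_uniq ?mem_lvl//=.
    rewrite eqxx big1 ?addr0 => [|t /negbTE -> //]; exact: mass_le.
rewrite big_const_seq count_predT size_lvl iter_addr_0 -[leLHS]mulr_natr -mulrA -natrM -expnD.
by rewrite -mulnDl subnK.
Qed.

(** Half of [c0 / 4 ^ k] minus the tolerance [c0 / 4 ^ k.+1] is exactly [c0 / 4 ^ k.+1], so the
    lower bound reproduces itself. *)
Let alive_mass k (x : nat -> D) : (forall l, ~~ bad l (mkseq x (Ns l.+1))) ->
  c0 / 4 ^+ k <= \sum_(s <- lvl D (Ns k) | alive k (mkseq x (Ns k)) s) m s.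
Proof.
move=> nb; elim: k => [|k IH].
  by rewrite Ns0 big_cons big_nil /= addr0 expr0 divr1.
have := nb k; rewrite /bad -leNgt.
set r := mkseq x (Ns k.+1).
have ar t : alive k r t = alive k (mkseq x (Ns k)) (take (Ns k) t).
  by rewrite -alive_take /r take_mkseq_le// Ns_homo.
rewrite (eq_bigl _ _ ar) (mass_level (alive k (mkseq x (Ns k))) (Ns_homo (leqnSn k))) => le.
apply: (@le_trans _ _ (\sum_(t <- lvl D (Ns k.+1) | alive k r t && fs k (gap r t)) m t)).
  apply: le_trans le; rewrite /e exprS invfM.
  by move: IH; set q := \sum_(_ <- _ | _) _; set z := (4 ^+ k)^-1; nra.
rewrite le_eqVlt; apply/orP; left; apply/eqP.
rewrite big_seq_cond [RHS]big_seq_cond; apply: eq_bigl => t.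
rewrite mem_lvl; case: eqP => //= tK; rewrite aliveS.
by rewrite -[in take (Ns k.+1) t]tK take_size /r take_oversize ?size_mkseq.
Qed.

(* A code [x] is bad at stage [k] when less than about half of the mass selected so far
   survives there; if it is never bad, some mass survives all stages. *)
Lemma selectors_cover : exists Bad : nat -> seq (seq D),
  [/\ forall k r, r \in Bad k -> size r = Ns k.+1,
      forall k, (size (Bad k))%:R <= c0 / 4 ^+ k.+1 * (2 ^ (Ns k.+1 * d))%:R &
      forall x : nat -> D, (forall k, mkseq x (Ns k.+1) \notin Bad k) ->
        exists2 y, E y & forall l, fs l (gap (mkseq x (Ns l.+1)) (mkseq y (Ns l.+1)))].
Proof.
exists (fun k => [seq r <- lvl D (Ns k.+1) | bad k r]); split.
- by move=> k r; rewrite mem_filter mem_lvl => /andP[_ /eqP].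
- by move=> k; rewrite size_filter; exact: count_bad.
move=> x xbad; have nb l : ~~ bad l (mkseq x (Ns l.+1)).
  by have := xbad l; rewrite mem_filter mem_lvl size_mkseq eqxx andbT.
have /choice[y yP] : forall k, exists y, E y /\ alive k (mkseq x (Ns k)) (mkseq y (Ns k)).
  move=> k; apply: contrapT => /forallNP ny.
  have := alive_mass k nb; apply/negP; rewrite -ltNge big1_seq ?divr_gt0 ?exprn_gt0//.
  move=> s /andP[sa]; rewrite mem_lvl => /eqP sN; apply/eqP; rewrite eq_le m_ge0 andbT leNgt.
  apply/negP => /(mass_gt0 psi_ge0 E_content)[y Ey sy]; apply: (ny y); split=> //.
  by rewrite (_ : mkseq y (Ns k) = s)// -sN; exact: sy.
(* For each [k] there is a point of [E] passing the first [k] tests. Each test reads a finite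
   prefix, so a limit of these points passes all of them, and it lies in the closed set [E]. *)
have [U UU Uoo] := exists_ultra.
have PU : ProperFilter U := @ultra_proper _ _ UU.
have [z yz] : exists z, forall n, U [set k | agree n (y k) z].
  apply: ultra_lim => // i; exists (enum D); apply: filterS (Uoo 0%N) => k _.
  by change (y k i \in enum D); rewrite mem_enum.
exists z.
  apply: E_closed => n; have [k /= kz] := filter_ex (yz n).
  by exists (y k); [move=> i ni; rewrite kz|exact: (yP k).1].
move=> l; have [k [/= kz lk]] := filter_ex (filterI (yz (Ns l.+1)) (Uoo l.+1)).
have := (yP k).2; move=> /allP /(_ l); rewrite mem_iota add0n lk => /(_ isT).
by rewrite !take_mkseq_le ?Ns_homo// (iffLR (agree_mkseq _ _ _) kz).
Qed.

End Covering.

End Selectors.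

(** * From codes to points of Euclidean space *)

Section CantorPoints.
Variables (R : realType) (d : nat).
Notation D := {ffun 'I_d -> bool}.
Notation pt := 'rV[R]_d.
Implicit Types (x y : nat -> D) (s : seq D) (i : 'I_d).

Let p2 n : 0 < (2 ^ n)%:R :> R. Proof. by rewrite ltr0n expn_gt0. Qed.

Definition lo s i : R := (dcoord s i)%:R / (2 ^ size s)%:R.
Definition hi s i : R := (dcoord s i).+1%:R / (2 ^ size s)%:R.

Lemma hi_lo s i : hi s i = lo s i + ((2 ^ size s)%:R)^-1.
Proof. by rewrite /hi /lo -addn1 natrD mulrDl mul1r. Qed.

Let lo_hi_mkseq x i m n : lo (mkseq x m) i <= hi (mkseq x n) i.
Proof.
have E k l : (k <= l)%N -> (dcoord (mkseq x k) i = dcoord (mkseq x l) i %/ 2 ^ (l - k))%N.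
  by move=> kl; rewrite -(take_mkseq_le x kl) dcoord_take ?size_mkseq.
rewrite /lo /hi !size_mkseq; have [mn|/ltnW nm] := leqP m n.
  rewrite ler_pdivrMr// mulrAC ler_pdivlMr// -!natrM ler_nat (E _ _ mn).
  have -> : (2 ^ n = 2 ^ (n - m) * 2 ^ m)%N by rewrite -expnD subnK.
  rewrite mulnA leq_mul2r; apply/orP; right.
  by rewrite (leq_trans (leq_trunc_div _ _)).
rewrite ler_pdivrMr// mulrAC ler_pdivlMr// -!natrM ler_nat (E _ _ nm).
have -> : (2 ^ m = 2 ^ (m - n) * 2 ^ n)%N by rewrite -expnD subnK.
rewrite mulnA leq_mul2r; apply/orP; right.
by rewrite ltnW// -ltn_divLR ?expn_gt0.
Qed.

Let lo_has_sup x i : has_sup (range (fun n => lo (mkseq x n) i)).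
Proof.
split; first by exists (lo (mkseq x 0) i); exists 0%N.
by exists (hi (mkseq x 0) i) => _ [n _ <-].
Qed.

Definition cantor_pt x : pt := \row_i sup (range (fun n => lo (mkseq x n) i)).

Lemma cantor_pt_lo x n i : lo (mkseq x n) i <= cantor_pt x 0 i.
Proof. by rewrite mxE; apply: ub_le_sup; [exact: (lo_has_sup x i).2|exists n]. Qed.

Lemma cantor_pt_hi x n i : cantor_pt x 0 i <= hi (mkseq x n) i.
Proof. by rewrite mxE; apply: ge_sup => [|_ [m _ <-]//]; exact: (lo_has_sup x i).1. Qed.

Lemma cantor_pt_agree x y n i : agree n x y ->
  `|cantor_pt x 0 i - cantor_pt y 0 i| <= ((2 ^ n)%:R)^-1.
Proof.
move=> /agree_mkseq xy; have := cantor_pt_lo x n i; have := cantor_pt_hi x n i.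
have := cantor_pt_lo y n i; have := cantor_pt_hi y n i.
by rewrite hi_lo xy hi_lo !size_mkseq ler_norml => *; apply/andP; split; lra.
Qed.

Lemma truncn_halve (t : R) : 0 <= t -> (Num.truncn (t * 2))./2 = Num.truncn t.
Proof.
move=> t0; apply/esym/eqP; rewrite truncn_eq//.
have /truncn_itv/andP[a b] : 0 <= t * 2 by rewrite mulr_ge0.
set q := Num.truncn (t * 2) in a b *.
have qE := odd_double_half q; rewrite -qE -muln2 in a b.
apply/andP; split; move: a b; rewrite -?natr1 natrD natrM; case: (odd q) => /= *; lra.
Qed.

Definition digits (p : pt) : nat -> D :=
  fun k => [ffun i => odd (Num.truncn (p 0 i * (2 ^ k.+1)%:R))].

Definition unit_cube : set pt := [set p | forall i, 0 <= p 0 i < 1].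

Lemma dcoord_digits p n i : unit_cube p ->
  dcoord (mkseq (digits p) n) i = Num.truncn (p 0 i * (2 ^ n)%:R).
Proof.
move=> p01; have /andP[p0 p1] := p01 i; elim: n => [|n IH].
  by apply/esym/eqP; rewrite truncn_eq mulr1 ?p0// /dcoord.
rewrite mkseqS dcoord_rcons IH ffunE -[in RHS](odd_double_half (Num.truncn _)) addnC.
by congr (_ + _)%N; rewrite expnSr natrM mulrA truncn_halve// mulr_ge0.
Qed.

Lemma digits_itv p n i : unit_cube p ->
  lo (mkseq (digits p) n) i <= p 0 i < hi (mkseq (digits p) n) i.
Proof.
move=> p01; have /andP[p0 _] := p01 i; rewrite /lo /hi size_mkseq dcoord_digits//.
rewrite ler_pdivrMr// ltr_pdivlMr//; apply: truncn_itv; exact: mulr_ge0.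
Qed.

Lemma eq_of_dyadic (a b : R) : (forall n, `|a - b| <= ((2 ^ n)%:R)^-1) -> a = b.
Proof.
move=> ab; apply/eqP; rewrite -subr_eq0 -normr_le0 leNgt; apply/negP => ab0.
have [N HN] := exp2_ge (2 / `|a - b|); have := ab N; apply/negP; rewrite -ltNge.
have := HN N (leqnn N); rewrite ler_pdivrMr// => h.
by rewrite -div1r ltr_pdivrMr// mulrC; lra.
Qed.

Lemma cantor_pt_digits p : unit_cube p -> cantor_pt (digits p) = p.
Proof.
move=> p01; apply/rowP => i; apply: eq_of_dyadic => n.
have := cantor_pt_lo (digits p) n i; have := cantor_pt_hi (digits p) n i.
have /andP[] := digits_itv n i p01; rewrite hi_lo size_mkseq ler_norml => *.
by apply/andP; split; lra.
Qed.

(** Suslin sets need not be stable under complement, so the class shown to be a sigma-algebra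
    consists of the sets for which both the preimage and its complement are Suslin. Preimages of
    open sets qualify because [cantor_pt] is continuous. *)
Lemma suslin_borel (A : set pt) (v : pt) : borel A ->
  suslin [set x | A (cantor_pt x + v)].
Proof.
pose good := [set A : set pt | suslin [set x | A (cantor_pt x + v)] /\
                               suslin [set x | ~ A (cantor_pt x + v)]].
suff sub : @borel R d `<=` good by move=> /sub[].
apply: smallest_sub.
  split.
  - split; first by apply: suslin_closed => x /(_ 0%N)[].
    apply: suslin_open => x; rewrite /setC /= => /(_ 0%N)[y _ ny].
    by exfalso; apply: ny.
  - move=> B [B1 B2]; split.
      by rewrite (_ : mkset _ = [set x | ~ B (cantor_pt x + v)])//; apply/seteqP; split=> x /= => [[]|].
    rewrite (_ : mkset _ = [set x | B (cantor_pt x + v)])//; apply/seteqP; split=> x /=.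
      by move=> nB; apply: contrapT => nBx; apply: nB.
    by move=> Bx [].
  - move=> F FP; split.
      rewrite (_ : mkset _ = \bigcup_n [set x | F n (cantor_pt x + v)]).
        by apply: suslin_bigcup => n; have [] := FP n.
      by apply/seteqP; split=> x [n _ Fx]; exists n.
    rewrite (_ : mkset _ = \bigcap_n [set x | ~ F n (cantor_pt x + v)]).
      by apply: suslin_bigcap => n; have [] := FP n.
    apply/seteqP; split=> [x nF n _ Fx|x nF [n _ Fx]]; first by apply: nF; exists n.
    exact: nF n I Fx.
move=> U Uo; have cl : prefix_closed [set x | ~ U (cantor_pt x + v)].
  move=> x xU Ux; have := open_nbhs_nbhs (conj Uo Ux) => /nbhs_ballP[e /= e0 eU].
  have [N HN] := exp2_ge (2 / e).
  have [y xy ny] := xU N; apply: ny; apply: eU; split=> // i j.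
  rewrite ord1 /ball /= !mxE opprD addrACA subrr addr0.
  have := cantor_pt_agree j xy; rewrite !mxE => /le_lt_trans; apply.
  have := HN N (leqnn N); rewrite ler_pdivrMr// => h.
  by rewrite -div1r ltr_pdivrMr// mulrC; lra.
split; last exact: suslin_closed.
apply: suslin_open; rewrite (_ : ~` _ = [set x | ~ U (cantor_pt x + v)])//.
Qed.

End CantorPoints.

(** * Lebesgue and Hausdorff measure through dyadic cubes *)

Section Outer.
Variables (R : realType) (d : nat).
Hypothesis d_gt0 : (0 < d)%N.
Notation D := {ffun 'I_d -> bool}.
Notation pt := 'rV[R]_d.

Definition ordered_pair (ab : pt * pt) := forall i, ab.1 0 i <= ab.2 0 i.

Lemma vol_ge0 (a b : pt) : (forall i, a 0 i <= b 0 i) -> 0 <= vol a b.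
Proof. by move=> ab; apply: prodr_ge0 => i _; rewrite subr_ge0. Qed.

Lemma lebesgue_outerE (E : set pt) : lebesgue_outer E =
  cover_cost ordered_pair (fun ab => box ab.1 ab.2) (fun ab => `|vol ab.1 ab.2|) E.
Proof.
apply/eqP; rewrite eq_le; apply/andP; split; apply: le_ereal_inf_tmp.
  move=> _ [u [uo uE] <-]; apply: ereal_inf_lbound.
  (* A missing piece becomes the degenerate box at the origin, of volume 0 because [d] is positive;
     an empty product would be 1. *)
  pose a n := if u n is Some ab then ab.1 else 0 : pt.
  pose b n := if u n is Some ab then ab.2 else 0 : pt.
  exists a, b; split.
  - by move=> n i; rewrite /a /b; case un : (u n) => [ab|]//; exact: uo un i.
  - move=> x /uE[n _]; case un : (u n) => [ab|]//= xab; exists n => //.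
    by rewrite /a /b un.
  - apply: eq_eseriesr => n _; rewrite /a /b; case un : (u n) => [ab|] /=.
      by rewrite /opt_cost ger0_norm//; apply: vol_ge0; exact: uo un.
    by rewrite /opt_cost /vol (bigD1 (Ordinal d_gt0))//= !mxE subrr mul0r.
move=> _ [a [b [ab Eab ->]]]; apply: ereal_inf_lbound; exists (fun n => Some (a n, b n)).
  by split=> [n q [<-]|x /Eab[n _ xn]]; [exact: ab|exists n].
by apply: eq_eseriesr => n _; rewrite /opt_cost ger0_norm//; apply: vol_ge0; exact: ab.
Qed.

Lemma lebesgue_outer_ge0 (E : set pt) : (0 <= lebesgue_outer E)%E.
Proof. by rewrite lebesgue_outerE; apply: cover_cost_ge0 => q. Qed.

Lemma lebesgue_outer_mono (E F : set pt) : E `<=` F -> (lebesgue_outer E <= lebesgue_outer F)%E.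
Proof. by rewrite !lebesgue_outerE; exact: cover_cost_mono. Qed.

Lemma lebesgue_outer_box (a b : pt) (E : set pt) : (forall i, a 0 i <= b 0 i) ->
  E `<=` box a b -> (lebesgue_outer E <= (vol a b)%:E)%E.
Proof.
move=> ab Eab; rewrite -[vol a b]ger0_norm ?vol_ge0// lebesgue_outerE.
exact: (cover_cost_node (q := (a, b)) _ ab Eab).
Qed.

Lemma lebesgue_outer_bigcup (E : nat -> set pt) :
  (lebesgue_outer (\bigcup_n E n) <= \sum_(0 <= n <oo) lebesgue_outer (E n))%E.
Proof.
rewrite lebesgue_outerE (eq_eseriesr (fun n _ => lebesgue_outerE (E n))).
exact: cover_cost_bigcup.
Qed.

Lemma lebesgue_outer_seq (I : eqType) (r : seq I) (F : I -> set pt) E :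
  (forall x, E x -> exists2 i, i \in r & F i x) ->
  (lebesgue_outer E <= \sum_(i <- r) lebesgue_outer (F i))%E.
Proof.
move=> EF; rewrite lebesgue_outerE (eq_bigr _ (fun i _ => lebesgue_outerE (F i))).
exact: cover_cost_seq EF.
Qed.

Lemma lebesgue_outer_null (I : countType) (F : I -> set pt) :
  (forall i, lebesgue_outer (F i) = 0%E) -> lebesgue_outer (\bigcup_i F i) = 0%E.
Proof.
move=> F0; rewrite lebesgue_outerE; apply: cover_cost_null => // i.
by rewrite -lebesgue_outerE.
Qed.

Lemma lebesgue_outer_shift (E : set pt) (v : pt) :
  (lebesgue_outer [set x : pt | E (x - v)%R] <= lebesgue_outer E)%E.
Proof.
apply: le_ereal_inf_tmp => _ [a [b [ab Eab ->]]]; apply: ereal_inf_lbound.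
exists (fun n => a n + v), (fun n => b n + v); split.
- by move=> n i; rewrite !mxE lerD2r.
- move=> x /Eab[n _ xn]; exists n => // i; have := xn i; rewrite !mxE => /andP[? ?].
  by apply/andP; split; lra.
- by apply: eq_eseriesr => n _; congr EFin; apply: eq_bigr => i _; rewrite !mxE; ring.
Qed.

Definition node_cell (s : seq D) : set pt :=
  [set p | unit_cube p /\ mkseq (digits p) (size s) = s].

Lemma lebesgue_outer_node_cell s :
  (lebesgue_outer (node_cell s) <= (((2 ^ (size s * d))%:R)^-1)%:E)%E.
Proof.
have -> : ((2 ^ (size s * d))%:R)^-1 = vol (\row_i lo R s i) (\row_i hi R s i).
  rewrite /vol (eq_bigr (fun=> ((2 ^ size s)%:R)^-1)) => [|i _]; last first.
    by rewrite !mxE hi_lo addrC addKr.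
  by rewrite prodr_const card_ord exprVn -natrX -expnM.
apply: lebesgue_outer_box => [i|p [p01 ps] i]; rewrite !mxE.
  by rewrite hi_lo lerDl invr_ge0.
by have := digits_itv (size s) i p01; rewrite ps => /andP[-> /ltW].
Qed.

Definition int_row (v : {ffun 'I_d -> int}) : pt := \row_i (v i)%:~R.

Lemma floor_split (p : pt) : exists v, unit_cube (p - int_row v).
Proof.
exists [ffun i => Num.floor (p 0 i)] => i; rewrite !mxE ffunE.
by have /andP[] := floor_itv (p 0 i); rewrite intrD => *; apply/andP; split; lra.
Qed.

Section Hausdorff.
Variable phi : R -> R.
Hypothesis phiP : gauge phi.

Lemma diam_ge0 (U : set pt) : (0 <= diam U)%E.
Proof. by apply: ereal_sup_ubound; left. Qed.

Lemma gauge_ge0 t : 0 <= t -> 0 <= phi t.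
Proof. by move=> t0; have [mono _ phi0 _] := phiP; rewrite -[leLHS]phi0; exact: mono. Qed.

Let gauge_diam_ge0 (U : set pt) : 0 <= phi (fine (diam U)).
Proof. by apply: gauge_ge0; rewrite fine_ge0// diam_ge0. Qed.

Lemma diam_set0 : diam (set0 : set pt) = 0%E.
Proof.
apply/eqP; rewrite eq_le diam_ge0 andbT; apply: ge_ereal_sup => _ [->//|[x []]].
Qed.

Lemma hausdorff_delta_le delta (E : set pt) : 0 < delta -> (hausdorff_delta phi delta E <=
  cover_cost [set U | diam U < delta%:E]%E id (fun U => phi (fine (diam U))) E)%E.
Proof.
move=> delta0; apply: le_ereal_inf_tmp => _ [u [uo uE] <-]; apply: ereal_inf_lbound.
exists (fun n => odflt set0 (u n)); split.
- by move=> x /uE[n _ xn]; exists n => //; move: xn; case: (u n).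
- move=> n; case un : (u n) => [U|] /=; first exact: uo un.
  by rewrite diam_set0 lte_fin.
- apply: eq_eseriesr => n _; case: (u n) => [U|] //=.
  by rewrite diam_set0 /=; have [_ _ ->] := phiP.
Qed.

(** The argument of [phi] is the Euclidean diameter of a cube of side [2 ^ -n]. *)
Definition node_gauge n := phi (Num.sqrt d%:R / (2 ^ n)%:R).

Let sd n : 0 < Num.sqrt d%:R / (2 ^ n)%:R :> R.
Proof. by rewrite divr_gt0 ?sqrtr_gt0 ?ltr0n ?expn_gt0. Qed.

Lemma node_gauge_ge0 n : 0 <= node_gauge n.
Proof. by apply: gauge_ge0; exact: ltW. Qed.

Lemma node_gauge_anti m n : (m <= n)%N -> node_gauge n <= node_gauge m.
Proof.
move=> mn; have [mono _ _ _] := phiP; apply: mono; first exact: ltW.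
by rewrite ler_pM2l ?sqrtr_gt0 ?ltr0n// lef_pV2 ?posrE ?ltr0n ?expn_gt0// ler_nat leq_exp2l.
Qed.

Lemma node_gauge_lim h : 0 < h -> exists M, node_gauge M <= h.
Proof.
move=> h0; have [_ rc phi0 _] := phiP.
have /cvgrPdist_lt /(_ h h0) phi_h := rc 0 (lexx 0).
have /nbhs_ballP[e /= e0 eP] : nbhs (0 : R) [set x | 0 < x -> `|phi 0 - phi x| < h] := phi_h.
have [M HM] := exp2_ge (2 * Num.sqrt d%:R / e).
have sM : Num.sqrt d%:R / (2 ^ M)%:R < e.
  have p2 : 0 < (2 ^ M)%:R :> R by rewrite ltr0n expn_gt0.
  have := HM M (leqnn M); rewrite ler_pdivrMr// ltr_pdivrMr// mulrC => h2.
  have s0 : 0 < Num.sqrt d%:R :> R by rewrite sqrtr_gt0 ltr0n.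
  lra.
exists M; have := eP (Num.sqrt d%:R / (2 ^ M)%:R); rewrite /ball /= sub0r normrN.
rewrite gtr0_norm// phi0 sub0r normrN => /(_ sM (sd M)); rewrite ger0_norm ?node_gauge_ge0//.
exact: ltW.
Qed.

Lemma edist_le (x y : pt) z : 0 <= z -> (forall i, `|x 0 i - y 0 i| <= z) ->
  Defs.edist x y <= Num.sqrt d%:R * z.
Proof.
move=> z0 xy; have {1}-> : z = Num.sqrt (z ^+ 2) by rewrite sqrtr_sqr ger0_norm.
rewrite -sqrtrM// /Defs.edist ler_sqrt ?mulr_ge0 ?sqr_ge0//.
rewrite mulr_natl -[X in _ *+ X]card_ord -sumr_const; apply: ler_sum => i _.
by rewrite -real_normK ?num_real// ler_pXn2r ?nnegrE.
Qed.

Definition node_image (v : pt) s : set pt := [set cantor_pt R x + v | x in cyl s].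

Lemma diam_node_image v s :
  (diam (node_image v s) <= (Num.sqrt d%:R / (2 ^ size s)%:R)%:E)%E.
Proof.
apply: ge_ereal_sup => _ [->|[_ [x sx <-] [_ [y sy <-] <-]]]; first by rewrite lee_fin ltW.
rewrite lee_fin; apply: edist_le => [|i]; first by rewrite invr_ge0.
rewrite !mxE opprD addrACA subrr addr0.
have := @cantor_pt_agree R d x y (size s) i; rewrite !mxE; apply.
by apply/agree_mkseq; rewrite sx sy.
Qed.

(** By monotonicity a cover of cost below [phi delta] contains only cubes of diameter below [delta].
    Zero content therefore gives arbitrarily cheap covers at every scale, and countably many integer
    translates of the unit cube exhaust [A]. *)
Lemma hausdorff_eq0 (A : set pt) :
  (forall v, net_content node_gauge [set x | A (cantor_pt R x + int_row v)] = 0) ->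
  (hausdorff phi A <= 0)%E.
Proof.
move=> A0; apply: ge_ereal_sup => _ [delta /= delta0 <-].
apply: (le_trans (hausdorff_delta_le _ delta0)).
set C := cover_cost _ _ _.
pose F v : set pt := [set cantor_pt R x + int_row v | x in [set x | A (cantor_pt R x + int_row v)]].
have AF : A `<=` \bigcup_v F v.
  move=> p Ap; have [v v01] := floor_split p; exists v => //.
  by exists (digits (p - int_row v)); rewrite /= cantor_pt_digits// subrK.
apply: (le_trans (cover_cost_mono _ _ _ AF)); rewrite cover_cost_null// => v.
apply/eqP; rewrite eq_le cover_cost_ge0// andbT; apply/lee_addgt0Pr => e e0; rewrite add0e.
have [mono _ _ phi_gt0] := phiP.
have /net_content_lt : net_content node_gauge [set x | A (cantor_pt R x + int_row v)]
    < Num.min e (phi delta) by rewrite A0 lt_min e0 phi_gt0.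
move=> /(_ node_gauge_ge0)[u [_ uA]]; rewrite EFin_min lt_min => /andP[ue udelta].
pose im (n : nat) := omap (node_image (int_row v)) (u n).
have small n s : u n = Some s -> Num.sqrt d%:R / (2 ^ size s)%:R < delta.
  move=> un; rewrite ltNge; apply/negP => h.
  have := @opt_cost_le_series R _ (fun s : seq D => node_gauge (size s)) (fun s => node_gauge_ge0 _) u n.
  rewrite un /= => /le_lt_trans /(_ udelta); rewrite lte_fin ltNge.
  by rewrite mono// ltW.
apply: (@le_trans _ _ (\sum_(0 <= n <oo) opt_cost (fun U : set pt => phi (fine (diam U))) (im n))%E).
  apply: cover_cost_le; split.
    move=> n q; rewrite /im; case un : (u n) => [s|]//= -[<-] /=.
    by rewrite (le_lt_trans (diam_node_image _ _))// lte_fin; exact: small un.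
  move=> p [x Ax <-]; have [n _ xn] := uA x Ax; exists n => //.
  by move: xn; rewrite /im; case: (u n) => //= s sx; exists x.
apply: (le_trans _ (ltW ue)); apply: lee_nneseries => [n _ _|n _].
  exact: opt_cost_ge0.
rewrite /im; case: (u n) => [s|]//=; rewrite lee_fin; apply: mono.
  by rewrite fine_ge0// diam_ge0.
have := diam_node_image (int_row v) s; have := diam_ge0 (node_image (int_row v) s).
by case: (diam _) => [r||]//=.
Qed.

End Hausdorff.

End Outer.

(** * The exceptional set and the theorem *)

Lemma nat_mod_of_int (b t v K : nat) (z : int) :
  b%:Z + z * (2 ^ K)%:Z = t%:Z + v%:Z - 1 -> b = t + (2 ^ K - 1) + v %[mod 2 ^ K].
Proof.
move=> bz; have K0 : (0 < 2 ^ K)%N by rewrite expn_gt0.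
have : (b%:Z = (t + (2 ^ K - 1) + v)%N%:Z %[mod (2 ^ K)%:Z])%Z.
  rewrite (_ : b%:Z = (- (z + 1)) * (2 ^ K)%:Z + (t + (2 ^ K - 1) + v)%N%:Z) ?modzMDl//.
  rewrite !PoszD -subzn//; move: bz; set P := (2 ^ K)%N%:Z; clearbody P => bz.
  have -> : b%:Z = t%:Z + v%:Z - 1 - z * P by rewrite -bz; ring.
  by ring.
by rewrite !modz_nat => -[].
Qed.

Section NullSet.
Variables (R : realType) (d : nat).
Hypothesis d_gt0 : (0 < d)%N.
Notation D := {ffun 'I_d -> bool}.
Notation pt := 'rV[R]_d.

(* The slack [h] makes the set closed without local finiteness of the union of cubes. *)
Definition fat (K : nat) (f : ('I_d -> nat) -> bool) : set pt :=
  [set p | forall h, 0 < h -> exists (b : 'I_d -> nat) (z : 'I_d -> int), f b /\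
    forall i, `|p 0 i * (2 ^ K)%:R - (b i)%:R - (z i)%:~R * (2 ^ K)%:R| <= 1 + h].

Lemma fat_closed K f : closed (fat K f).
Proof.
move=> p pcl h h0; have K0 : 0 < (2 ^ K)%:R :> R by rewrite ltr0n expn_gt0.
pose e := h / 2 / (2 ^ K)%:R.
have e0 : 0 < e by rewrite !divr_gt0.
have [q [qf pq]] := pcl _ (nbhsx_ballx p e e0).
have [|b [z [fb bz]]] := qf (h / 2); first by rewrite divr_gt0.
exists b, z; split=> // i.
have pqi : `|p 0 i - q 0 i| * (2 ^ K)%:R <= h / 2.
  by rewrite -ler_pdivlMr// ltW//; have [_ /(_ 0 i)] := pq.
rewrite (_ : _ - _ - _ = (p 0 i - q 0 i) * (2 ^ K)%:R +
    (q 0 i * (2 ^ K)%:R - (b i)%:R - (z i)%:~R * (2 ^ K)%:R)); last by ring.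
apply: le_trans (ler_normD _ _) _; rewrite normrM [X in _ * X]ger0_norm; last exact: ltW.
have := bz i; lra.
Qed.

Lemma fat_int_row K f p v : fat K f p -> fat K f (p + int_row R v).
Proof.
move=> pf h h0; have [b [z [fb bz]]] := pf h h0.
exists b, (fun i => z i + v i); split=> // i; rewrite (_ : _ - _ - _ = p 0 i * (2 ^ K)%:R - (b i)%:R - (z i)%:~R * (2 ^ K)%:R)//.
by rewrite !mxE intrD; move: (p 0 i) ((2 ^ K)%:R : R) (b i)%:R => *; ring.
Qed.

(** Each of the two points lies within one grid step above its lower corner, so the difference is
    within one step of the difference of the corners: this is the radius 1 in [fat]. The choice
    [z = -1] removes the modulus that [gap] adds. *)
Lemma fat_sub K (f : ('I_d -> nat) -> bool) (x y : nat -> D) (p : pt) : unit_cube p -> mkseq x K = mkseq (digits p) K ->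
  f (gap (mkseq x K) (mkseq y K)) -> fat K f (p - cantor_pt R y).
Proof.
move=> p01 xp fg h h0; exists (gap (mkseq x K) (mkseq y K)), (fun=> -1); split=> // i.
have K0 : 0 < (2 ^ K)%:R :> R by rewrite ltr0n expn_gt0.
have := dcoord_lt (mkseq y K) i; rewrite /gap size_mkseq => yK.
rewrite natrD natrB; last exact: ltnW.
have := digits_itv K i p01; rewrite -xp /lo /hi size_mkseq.
rewrite ler_pdivrMr// ltr_pdivlMr// => /andP[a1 a2].
have := cantor_pt_lo R y K i; rewrite /lo size_mkseq ler_pdivrMr// => b1.
have := cantor_pt_hi R y K i; rewrite /hi size_mkseq ler_pdivlMr// => b2.
rewrite [(p - _) 0 i]mxE [(- cantor_pt R y) 0 i]mxE.
move: a1 a2 b1 b2; rewrite -![_.+1%:R]natr1.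
move: (cantor_pt R y 0 i) (p 0 i) ((2 ^ K)%:R : R) (dcoord _ i)%:R (dcoord _ i)%:R => c q P u w.
by rewrite mulrN1z ler_norml => *; apply/andP; split; lra.
Qed.

Lemma fat_digits K (f : ('I_d -> nat) -> bool) (p : pt) :
  (forall y y', (forall k, y k = y' k %[mod 2 ^ K]) -> f y = f y') ->
  unit_cube p -> fat K f p -> [exists v : {ffun 'I_d -> 'I_4},
    f (fun k => dcoord (mkseq (digits p) K) k + (2 ^ K - 1) + v k)%N].
Proof.
move=> fmod p01 /(_ 2^-1) [|b [z [fb bz]]]; first by rewrite invr_gt0.
have [v vP] : {v : 'I_d -> 'I_4 & forall i, (b i)%:Z + z i * (2 ^ K)%:Z =
    (dcoord (mkseq (digits p) K) i)%:Z + (v i)%:Z - 1}.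
  apply: (@choice _ _ (fun i (v : 'I_4) => (b i)%:Z + z i * (2 ^ K)%:Z =
    (dcoord (mkseq (digits p) K) i)%:Z + (v : nat)%:Z - 1)) => i.
  have K0 : 0 < (2 ^ K)%:R :> R by rewrite ltr0n expn_gt0.
  have := digits_itv K i p01; rewrite /lo /hi size_mkseq.
  rewrite ler_pdivrMr// ltr_pdivlMr// -natr1 => /andP[a1 a2].
  have := bz i; rewrite ler_norml => /andP[b1 b2].
  pose del : int := (b i)%:Z + z i * (2 ^ K)%:Z - (dcoord (mkseq (digits p) K) i)%:Z.
  have delE : del%:~R = (b i)%:R + (z i)%:~R * (2 ^ K)%:R - (dcoord (mkseq (digits p) K) i)%:R :> R.
    by rewrite /del intrB intrD intrM -!pmulrn.
  have d1 : -2 < del.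
    rewrite -(ltr_int R) delE; move: a1 a2 b1 b2.
    move: (p 0 i) ((2 ^ K)%:R : R) (dcoord _ i)%:R (b i)%:R (z i)%:~R => *; lra.
  have d2 : del < 3.
    rewrite -(ltr_int R) delE; move: a1 a2 b1 b2.
    move: (p 0 i) ((2 ^ K)%:R : R) (dcoord _ i)%:R (b i)%:R (z i)%:~R => *; lra.
  (* With slack 1/2 the integer [del] is between -1 and 2, whence four values of [v]; the offset 1
     returns as the [2 ^ K - 1] of the selector. *)
  exists (inord (absz (del + 1))); rewrite inordK; last by move: d1 d2; clearbody del; lia.
  rewrite gez0_abs; last by move: d1 d2; clearbody del; lia.
  by rewrite /del; ring.
apply/existsP; exists [ffun i => v i]; rewrite -(fmod b)// => k.
by rewrite ffunE; exact: nat_mod_of_int (vP k).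
Qed.

Variables (psi e : nat -> R) (Ns : nat -> nat) (fs : nat -> ('I_d -> nat) -> bool).
Hypothesis Ns0 : Ns 0%N = 0%N.
Hypothesis fsP : forall k, selects psi (Ns k) (e k) (Ns k.+1) (fs k).

Definition limit_set : set pt := \bigcap_l fat (Ns l.+1) (fs l).

Lemma limit_set_closed : closed limit_set.
Proof. by apply: closed_bigI => l _; exact: fat_closed. Qed.

Lemma limit_set_int_row p v : limit_set p -> limit_set (p + int_row R v).
Proof. by move=> pl l _; apply: fat_int_row; exact: pl. Qed.

(** Induction on the number [n] of stages still to be used: among the cells of the next level inside
    [s], at most three quarters can meet the set. *)
Let limit_set_cell n l s : size s = Ns l ->
  (lebesgue_outer (limit_set `&` node_cell s)
    <= ((3 / 4) ^+ n / (2 ^ (size s * d))%:R)%:E)%E.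
Proof.
elim: n l s => [|n IH] l s sN.
  rewrite expr0 mul1r; apply: le_trans (lebesgue_outer_node_cell R d_gt0 s).
  by apply: lebesgue_outer_mono => // p [].
have [NK fmod fat4 _] := fsP l; set N := Ns l in sN NK fat4; set K := Ns l.+1 in NK fmod fat4.
pose T := [seq t <- lvl D K | (take N t == s) && [exists v : {ffun 'I_d -> 'I_4},
   fs l (fun k => dcoord t k + (2 ^ K - 1) + v k)%N]].
apply: (@le_trans _ _ (\sum_(t <- T) lebesgue_outer (limit_set `&` node_cell t))%E).
  apply: lebesgue_outer_seq => // p [pl [p01 ps]].
  exists (mkseq (digits p) K); last by split=> //; split=> //; rewrite size_mkseq.
  rewrite mem_filter mem_lvl size_mkseq eqxx andbT take_mkseq_le// -{1}sN ps eqxx /=.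
  by apply: fat_digits => //; exact: pl.
apply: (@le_trans _ _ (\sum_(t <- T) ((3 / 4) ^+ n / (2 ^ (K * d))%:R)%:E)%E).
  rewrite big_seq [leRHS]big_seq; apply: lee_sum => t.
  by rewrite mem_filter mem_lvl => /andP[_ /eqP tK]; rewrite -tK; exact: IH tK.
rewrite sumEFin lee_fin big_const_seq count_predT iter_addr_0 -[leLHS]mulr_natr.
have := fat4 s sN; rewrite -size_filter -/T -(ler_nat R) !natrM => T4.
rewrite sN; have -> : (2 ^ (K * d))%:R = (2 ^ ((K - N) * d))%:R * (2 ^ (N * d))%:R :> R.
  by rewrite -natrM -expnD -mulnDl subnK.
have V0 : 0 < (2 ^ ((K - N) * d))%:R :> R by rewrite ltr0n expn_gt0.
have W0 : 0 < (2 ^ (N * d))%:R :> R by rewrite ltr0n expn_gt0.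
have Q0 : 0 <= (3 / 4 : R) ^+ n by rewrite exprn_ge0.
rewrite exprSr; move: V0 W0 Q0 T4; move: (2 ^ ((K - N) * d))%:R (2 ^ (N * d))%:R => V W.
move: ((3 / 4) ^+ n) (size T)%:R => Q sT V0 W0 Q0 T4.
have -> : Q / (V * W) * sT = Q * (sT / V) / W by rewrite invfM; ring.
rewrite ler_pM2r ?invr_gt0//; apply: ler_wpM2l => //.
by rewrite ler_pdivrMr//; lra.
Qed.

Lemma limit_set_null : lebesgue_outer limit_set = 0%E.
Proof.
have null0 : lebesgue_outer (limit_set `&` @unit_cube R d) = 0%E.
  apply/eqP; rewrite eq_le lebesgue_outer_ge0// andbT.
  apply/lee_addgt0Pr => h h0; rewrite add0e.
  have [n /= nP] : exists n, (3 / 4 : R) ^+ n <= h.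
    have : (fun n => (3 / 4 : R) ^+ n) @ \oo --> (0 : R).
      by apply: cvg_expr; rewrite ger0_norm; lra.
    move=> /cvgrPdist_le /(_ h h0)[n _ /(_ n (leqnn n))]; rewrite sub0r normrN.
    by move=> /(le_trans (ler_norm _)) ?; exists n.
  have := @limit_set_cell n 0%N [::] (esym Ns0); rewrite mul0n divr1 => le.
  apply: le_trans (_ : _ <= ((3 / 4) ^+ n)%:E)%E _; last by rewrite lee_fin.
  apply: le_trans le; apply: lebesgue_outer_mono => // p [pl p01]; split=> //; split=> //.
apply/eqP; rewrite eq_le lebesgue_outer_ge0// andbT.
pose F v : set pt := [set p : pt | (limit_set `&` @unit_cube R d) (p - int_row R v)].
rewrite -(lebesgue_outer_null d_gt0 (F := F)).
  apply: lebesgue_outer_mono => // p pl; have [v v01] := floor_split p.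
  exists v => //; split=> //; have := limit_set_int_row [ffun i => - v i] pl.
  congr (limit_set (_ + _)); apply/rowP => i; by rewrite !mxE ffunE intrN.
move=> v; apply/eqP; rewrite eq_le lebesgue_outer_ge0// andbT.
by rewrite -null0 lebesgue_outer_shift.
Qed.

End NullSet.

Lemma sum_quarter_pow (R : realType) (c : R) n : 0 <= c ->
  \sum_(0 <= k < n) c / 4 ^+ k.+1 <= c.
Proof.
move=> c0; suff -> : \sum_(0 <= k < n) c / 4 ^+ k.+1 = c / 3 * (1 - (4 ^+ n)^-1).
  have : 0 <= ((4 : R) ^+ n)^-1 by rewrite invr_ge0 exprn_ge0.
  by nra.
elim: n => [|n IH]; first by rewrite big_geq// expr0 invr1 subrr mulr0.
rewrite big_nat_recr//= IH exprS invfM; move: ((4 : R) ^+ n)^-1 => x; lra.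
Qed.

Lemma bad_cells_measure (R : realType) d (hd : (0 < d)%N) (c : R) (Ns : nat -> nat)
    (Bad : nat -> seq (seq {ffun 'I_d -> bool})) : 0 <= c ->
  (forall k r, r \in Bad k -> size r = Ns k.+1) ->
  (forall k, (size (Bad k))%:R <= c / 4 ^+ k.+1 * (2 ^ (Ns k.+1 * d))%:R) ->
  (lebesgue_outer [set p : 'rV[R]_d | unit_cube p /\
     exists k, mkseq (digits p) (Ns k.+1) \in Bad k] <= c%:E)%E.
Proof.
move=> c0 Badsz Badle.
pose H k : set 'rV[R]_d := [set p | unit_cube p /\ mkseq (digits p) (Ns k.+1) \in Bad k].
have HE : [set p : 'rV[R]_d | unit_cube p /\ exists k, mkseq (digits p) (Ns k.+1) \in Bad k]
    `<=` \bigcup_k H k by move=> p [p01 [k pk]]; exists k.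
apply: (le_trans (lebesgue_outer_mono hd HE)); apply: (le_trans (lebesgue_outer_bigcup hd _)).
apply: lime_le.
  by apply: is_cvg_nneseries => n _ _; exact: lebesgue_outer_ge0.
apply: nearW => n; apply: (@le_trans _ _ (\sum_(0 <= k < n) (c / 4 ^+ k.+1)%:E)%E); last first.
  by rewrite sumEFin lee_fin sum_quarter_pow.
apply: lee_sum => k _.
apply: (@le_trans _ _ (\sum_(r <- Bad k) lebesgue_outer (node_cell r : set 'rV[R]_d))%E).
  apply: lebesgue_outer_seq => // p [p01 pk]; exists (mkseq (digits p) (Ns k.+1)) => //.
  by split=> //; rewrite size_mkseq.
apply: (@le_trans _ _ (\sum_(r <- Bad k) (((2 ^ (Ns k.+1 * d))%:R)^-1)%:E)%E).
  rewrite big_seq [leRHS]big_seq; apply: lee_sum => r /Badsz <-.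
  exact: lebesgue_outer_node_cell.
rewrite sumEFin lee_fin big_const_seq count_predT iter_addr_0 -[leLHS]mulr_natr.
by rewrite mulrC ler_pdivrMr// ltr0n expn_gt0.
Qed.

Lemma exists_inv_le (R : realType) (t : R) : 0 < t -> exists j : nat, j.+1%:R^-1 <= t.
Proof.
move=> t0; exists (Num.truncn t^-1); rewrite -[leRHS]invrK lef_pV2 ?posrE ?invr_gt0//.
exact: ltW (truncnS_gt _).
Qed.

Theorem theorem1p3 (R : realType) (d : nat) (hd : (0 < d)%N)
    (phi : R -> R) (hphi : gauge phi) :
  exists B : set 'rV[R]_d,
    [/\ Fsigma B, lebesgue_outer B = 0%E &
        forall A : set 'rV[R]_d, borel A -> (0 < hausdorff phi A)%E ->
          lebesgue_outer (~` sumset A B) = 0%E].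
Proof.
pose psi := node_gauge d phi.
have psi_ge0 : forall n, 0 <= psi n by exact: node_gauge_ge0.
have psi_anti : forall m n, (m <= n)%N -> psi n <= psi m by exact: node_gauge_anti.
have psi_lim : forall h, 0 < h -> exists M, psi M <= h by exact: node_gauge_lim.
pose c j : R := j.+1%:R^-1.
have c_gt0 j : 0 < c j by rewrite invr_gt0.
have c_le1 j : c j <= 1 by rewrite invf_le1// ler1n.
have [NF NFP] : {NF : nat -> (nat -> nat) * (nat -> ('I_d -> nat) -> bool) & forall j,
    (NF j).1 0%N = 0%N /\
    forall k, selects psi ((NF j).1 k) (c j / 4 ^+ k.+1) ((NF j).1 k.+1) ((NF j).2 k)}.
  apply: (@choice _ _ (fun j NF => NF.1 0%N = 0%N /\
    forall k, selects psi (NF.1 k) (c j / 4 ^+ k.+1) (NF.1 k.+1) (NF.2 k))) => j.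
  have [|Ns [fs H]] := selector_sequence (Ordinal hd) psi_ge0 psi_lim (e := fun k => c j / 4 ^+ k.+1).
    by move=> k; rewrite divr_gt0// exprn_gt0.
  by exists (Ns, fs).
pose B : set 'rV[R]_d := \bigcup_j limit_set (NF j).1 (NF j).2.
exists B; split.
- by exists (fun j => limit_set (NF j).1 (NF j).2); split=> // j; exact: limit_set_closed.
- apply: lebesgue_outer_null => // j; have [N0 NP] := NFP j.
  exact: (limit_set_null hd N0 NP).
move=> A Aborel A_gt0.
(* If every integer piece of [A] had content zero, its Hausdorff measure would vanish; so some unit
   cube carries a piece of positive content. *)
have [v v0] : exists v, net_content psi [set x | A (cantor_pt R x + int_row R v)] != 0.
  apply: contrapT => /forallNP nv; have := hausdorff_eq0 hd hphi (A := A).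
  move=> /(_ (fun v => _)) H; move: A_gt0; rewrite ltNge => /negP; apply; apply: H => v.
  by apply/eqP/negPn/negP; exact: nv.
set a := net_content psi _ in v0.
have a0 : 0 < a by rewrite lt_def v0 net_content_ge0.
(* Capacitability needs a level strictly below the content, hence the half. *)
have [|E [EA Ecl Ea]] := suslin_capacitable psi_ge0 psi_anti (c := a / 2)
    (suslin_borel (int_row R v) Aborel).
  by rewrite -/a; lra.
have Bint p u : B p -> B (p + int_row R u).
  by move=> [j _ pj]; exists j => //; exact: limit_set_int_row.
pose G := @unit_cube R d `&` ~` sumset A B.
have G0 : lebesgue_outer G = 0%E.
  apply/eqP; rewrite eq_le lebesgue_outer_ge0// andbT.
  apply/lee_addgt0Pr => h h0; rewrite add0e.
  (* The stage constant must be at most [h], to bound the exceptional measure, and at most [a / 2],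
     so that [E] carries a mass distribution of that total. *)
  have [|j cj] := @exists_inv_le R (Num.min h (a / 2)); first by rewrite lt_min h0 divr_gt0.
  have [ch ca] : c j <= h /\ c j <= a / 2 by move: cj; rewrite le_min => /andP[].
  have [N0 NP] := NFP j.
  have [Bad [Badsz Badle Badcov]] :=
    selectors_cover psi_ge0 (c_gt0 j) (c_le1 j) N0 NP Ecl (le_trans ca Ea).
  apply: le_trans (_ : _ <= (c j)%:E)%E _; last by rewrite lee_fin.
  apply: le_trans (bad_cells_measure hd (ltW (c_gt0 j)) Badsz Badle).
  apply: lebesgue_outer_mono => // p [p01 pAB]; split=> //; apply: contrapT => /forallNP nb.
  have [k|y Ey yP] := Badcov (digits p); first exact/negP/nb.
  (* The piece of [A] sits in the cube with corner [v]; this shift is absorbed by the invariance of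
     [B] under integer translations. *)
  apply: pAB; exists (cantor_pt R y + int_row R v), (p - cantor_pt R y - int_row R v); split.
  + exact: EA.
  + have -> : - int_row R v = int_row R [ffun i => - v i].
      by apply/rowP => i; rewrite !mxE ffunE intrN.
    apply: Bint; exists j => // l _; exact: fat_sub p01 _ (yP l).
  + by rewrite -[X in _ = _ + X]addrA -opprD [RHS]addrC subrK.
apply/eqP; rewrite eq_le lebesgue_outer_ge0// andbT.
pose F u : set 'rV[R]_d := [set p : 'rV[R]_d | G (p - int_row R u)].
rewrite -(lebesgue_outer_null hd (F := F)).
  apply: lebesgue_outer_mono => // p pAB; have [u u01] := floor_split p.
  exists u => //; split=> // -[q [b [Aq Bb pqb]]]; apply: pAB.
  by exists q, (b + int_row R u); split=> //; [exact: Bint|rewrite addrA -pqb subrK].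
move=> u; apply/eqP; rewrite eq_le lebesgue_outer_ge0// andbT.
by rewrite -G0 lebesgue_outer_shift.
Qed.
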